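(* Let $D,r,Q$ be positive integers and $\epsilon>0$. There exists a positive integer $k_0=k_0(D,r,Q,\epsilon)$ such that the following holds. Let $T:\mathbb{Z}^r\curvearrowright(X,\mu)$ be an ergodic measure preserving action and $B\subset X$ with $\mu(B)>\epsilon$. Then there exists a positive integer $k=k(B)\le k_0$ such that for every polynomial map $P:\mathbb{Z}\to\mathbb{Z}^r$, $P(n)=(P_1(n),\dots,P_r(n))$ with $P_i\in\mathbb{Z}[n]$ and $\deg P_i\le D$, which has multiplicative complexity $Q$ and whose image is hyperplane-fleeing, there exist arbitrarily large $n\in\mathbb{Z}$ with $\mu(T^{kP(n)}B\cap B)>0$.
   Context: A polynomial map $P=(P_1,\dots,P_r)$ with $P_i\in\mathbb{Z}[n]$ has multiplicative complexity $Q$ if for all $\vec a=(a_1,\dots,a_r)\in\mathbb{Z}^r$ and $q\in\mathbb{Z}$ with $\gcd(a_1,\dots,a_r,q)=1$, writing $(P(n)-P(0))\cdot\vec a=\sum_{j=1}^{D}b_jn^j$, one has $\gcd(b_1,\dots,b_D,q)\le Q$. A set $S\subset\mathbb{R}^r$ is hyperplane-fleeing if it is not contained in any proper affine subspace of $\mathbb{R}^r$. A measure preserving action $T:\mathbb{Z}^r\curvearrowright(X,\mu)$ is an action on a probability space by measure preserving maps; it is ergodic if every invariant measurable set has measure $0$ or $1$. *)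

(* Defs.v *)
From HB Require Import structures.
From mathcomp Require Import all_boot all_order all_algebra.
From mathcomp Require Import all_classical all_reals all_analysis.
Set Implicit Arguments. Unset Strict Implicit. Unset Printing Implicit Defensive.
Import Order.TTheory GRing.Theory Num.Theory.
Local Open Scope classical_set_scope.
Local Open Scope ring_scope.

Definition gcdz_seq (s : seq int) : int := foldr gcdz 0 s.

Definition polyvec_eval (r : nat) (P : 'I_r -> {poly int}) (n : int) : 'rV[int]_r :=
  \row_i (P i).[n].

Definition mult_complexity (r D : nat) (P : 'I_r -> {poly int}) (Q : nat) : Prop :=
  forall (a : 'I_r -> int) (q : int),
    gcdz_seq (q :: [seq a i | i <- enum 'I_r]) = 1 ->
    let b := \sum_(i < r) a i *: (P i - ((P i)`_0)%:P) in
    gcdz_seq (q :: [seq b`_j.+1 | j <- iota 0 D]) <= Q%:Z.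

(* The image {P(n) : n in Z} is not contained in any proper affine subspace
   of R^r, i.e. in no affine hyperplane {x | sum_i c_i x_i = t} with c <> 0. *)
Definition hyperplane_fleeing (R : realType) (r : nat) (P : 'I_r -> {poly int}) : Prop :=
  forall (c : 'I_r -> R) (t : R), (exists i, c i != 0) ->
    exists n : int, \sum_(i < r) c i * ((P i).[n])%:~R != t.

Definition mp_action (R : realType) (d : measure_display) (X : measurableType d)
    (mu : probability X R) (r : nat) (T : 'rV[int]_r -> X -> X) : Prop :=
  [/\ T 0 = id,
      (forall u v, T (u + v) = T u \o T v),
      (forall u, measurable_fun setT (T u)) &
      (forall u (A : set X), measurable A -> mu (T u @^-1` A) = mu A)].

Definition ergodic_action (R : realType) (d : measure_display) (X : measurableType d)
    (mu : probability X R) (r : nat) (T : 'rV[int]_r -> X -> X) : Prop :=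
  forall A : set X, measurable A -> (forall u, T u @^-1` A = A) ->
    mu A = 0%E \/ mu A = 1%E.

(* Main.v *)
Require Import Defs.
From HB Require Import structures.
From mathcomp Require Import all_boot all_order all_algebra.
From mathcomp Require Import all_classical all_reals all_analysis.
From mathcomp Require Import measurable_realfun algC cyclotomic ring zify.
Import Order.TTheory GRing.Theory Num.Theory.
Set Implicit Arguments. Unset Strict Implicit. Unset Printing Implicit Defensive.
Local Open Scope classical_set_scope.
Local Open Scope ring_scope.

(* Deleting countably many null sets from [B] and averaging over an orbit turns
   the statement into one about dense subsets [A] of a box in Z^r, whose
   difference set must meet [{k P(n)}].  Embed the box in (Z/L)^r and put the weight
   [|A^(xi)|^2] on each frequency [xi].  Averages of the character [k xi . P(n)] are
   small unless [W k xi] is close to [0] in the torus, where [W] depends only on [D],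
   [Q] and the required smallness.  With [k_j = W^j] the sets [E_j] of frequencies
   such that [k_j xi] is close to [0] increase with [j]; hence for some [j] below a
   bound depending on the density only, [E_j.+1] minus [E_j] has little weight, and
   for [k = k_j] the contribution of [xi = 0] to the number of solutions survives.
   All characters are integer powers of one [z] with [`|z| = 1], and closeness of
   [m] to the multiples of the period is measured by [`|z ^ m - 1|]. *)

(** * Distance to 1 of integer powers of a unit complex number *)

Definition circ_dist (C : numClosedFieldType) (z : C) (m : int) : C := `|z ^ m - 1|.

Lemma circ_neq0 (C : numClosedFieldType) (z : C) : `|z| = 1 -> z != 0.
Proof. by move=> z1; rewrite -normr_eq0 z1 oner_eq0. Qed.

Lemma norm_circX (C : numClosedFieldType) (z : C) (m : int) : `|z| = 1 -> `|z ^ m| = 1.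
Proof.
move=> z1; case: m => n; first by rewrite -exprnP normrX z1 expr1n.
by rewrite NegzE -exprnN normfV normrX z1 expr1n invr1.
Qed.

Lemma conj_circX (C : numClosedFieldType) (z : C) (m : int) : `|z| = 1 -> (z ^ m)^* = z ^ (- m).
Proof.
move=> z1; have := norm_circX m z1 => h.
rewrite -[LHS]mul1r -(mulVf (circ_neq0 h)) -mulrA -normCK h expr1n mulr1.
by rewrite -invr_expz.
Qed.

Lemma circ_dist_ge0 (C : numClosedFieldType) (z : C) (m : int) : 0 <= circ_dist z m.
Proof. exact: normr_ge0. Qed.

Lemma circ_distN (C : numClosedFieldType) (z : C) m : `|z| = 1 -> circ_dist z (- m) = circ_dist z m.
Proof.
move=> z1; by rewrite /circ_dist -norm_conjC rmorphB rmorph1 /= conj_circX // opprK.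
Qed.

Lemma circ_distD (C : numClosedFieldType) (z : C) m n : `|z| = 1 ->
  circ_dist z (m + n) <= circ_dist z m + circ_dist z n.
Proof.
move=> z1; rewrite /circ_dist expfzDr ?circ_neq0 //.
have -> : z ^ m * z ^ n - 1 = z ^ m * (z ^ n - 1) + (z ^ m - 1) by ring.
by apply: (le_trans (ler_normD _ _)); rewrite normrM norm_circX // mul1r addrC.
Qed.

Lemma circ_distM (C : numClosedFieldType) (z : C) (m n : int) : `|z| = 1 ->
  circ_dist z (m * n) <= `|m|%N%:R * circ_dist z n.
Proof.
move=> z1.
have nat_case (k : nat) : circ_dist z (k%:Z * n) <= k%:R * circ_dist z n.
  elim: k => [|k IH]; first by rewrite mul0r /circ_dist expr0z subrr normr0 mul0r.
  rewrite -addn1 PoszD mulrDl mul1r natrD mulrDl mul1r.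
  by apply: (le_trans (circ_distD _ _ z1)); rewrite lerD2r.
case: m => k; first exact: nat_case.
by rewrite NegzE mulNr circ_distN // abszN; apply: nat_case.
Qed.

Lemma circ_dist_sum (C : numClosedFieldType) (z : C) (I : Type) (s : seq I)
    (P : pred I) (F : I -> int) : `|z| = 1 ->
  circ_dist z (\sum_(i <- s | P i) F i) <= \sum_(i <- s | P i) circ_dist z (F i).
Proof.
move=> z1; elim/big_rec2: _ => [|i y x _ h].
  by rewrite /circ_dist expr0z subrr normr0.
by apply: (le_trans (circ_distD _ _ z1)); rewrite lerD2l.
Qed.

Lemma norm_circ_sum_le (C : numClosedFieldType) (z : C) (I : Type) (s : seq I)
    (P : pred I) (F : I -> int) : `|z| = 1 ->
  `|\sum_(i <- s | P i) z ^ F i| <= \sum_(i <- s | P i) (1 : C).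
Proof.
move=> z1; apply: (le_trans (ler_norm_sum _ _ _)).
by apply: ler_sum => i _; rewrite norm_circX.
Qed.

(** * Integer sequences with constant iterated differences *)

(* For a polynomial [f] of degree [d], [b] is [d`!] times the leading coefficient. *)
Fixpoint const_diff (d : nat) (b : int) (f : nat -> int) : Prop :=
  if d is d'.+1 then
    forall h : nat, const_diff d' (h%:Z * b) (fun n => f (n + h)%N - f n)
  else forall n, f n = b.

Lemma eq_const_diff d b f g : f =1 g -> const_diff d b f -> const_diff d b g.
Proof.
elim: d b f g => [|d IH] b f g fg /= hf; first by move=> n; rewrite -fg.
by move=> h; apply: IH (hf h) => n; rewrite !fg.
Qed.

Lemma const_diffD d b c f g : const_diff d b f -> const_diff d c g ->
  const_diff d (b + c) (fun n => f n + g n).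
Proof.
elim: d b c f g => [|d IH] b c f g /= hf hg; first by move=> n; rewrite hf hg.
move=> h; rewrite mulrDr; apply: eq_const_diff (IH _ _ _ _ (hf h) (hg h)) => n /=; ring.
Qed.

Lemma const_diffM d b c f : const_diff d b f -> const_diff d (c * b) (fun n => c * f n).
Proof.
elim: d b f => [|d IH] b f /= hf; first by move=> n; rewrite hf.
move=> h; rewrite mulrCA; apply: eq_const_diff (IH _ _ (hf h)) => n /=; ring.
Qed.

Lemma const_diff_raise d b f : const_diff d b f -> const_diff d.+1 0 f.
Proof.
elim: d b f => [|d IH] b f /= hf h; first by move=> n; rewrite !hf mulr0 subrr.
by rewrite mulr0; apply: (IH _ _ (hf h)).
Qed.

Lemma const_diff_lt d e b f : (e < d)%N -> const_diff e b f -> const_diff d 0 f.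
Proof.
elim: d => // d IH; rewrite ltnS leq_eqVlt => /predU1P[-> /const_diff_raise //|ed hf].
exact: const_diff_raise (IH ed hf).
Qed.

Lemma const_diff_shift d b f a : const_diff d b f -> const_diff d b (fun n => f (n + a)%N).
Proof.
elim: d b f => [|d IH] b f /= hf; first by move=> n; rewrite hf.
by move=> h; apply: eq_const_diff (IH _ _ (hf h)) => n /=; rewrite addnAC.
Qed.

Lemma const_diff_dilate d b f (s : nat) : const_diff d b f ->
  const_diff d (s%:Z ^+ d * b) (fun n => f (s * n)%N).
Proof.
elim: d b f => [|d IH] b f /= hf; first by move=> n; rewrite hf expr0 mul1r.
move=> h; have := IH _ _ (hf (s * h)%N).
have -> : s%:Z ^+ d * ((s * h)%N%:Z * b) = h%:Z * (s%:Z ^+ d.+1 * b).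
  by rewrite PoszM exprS; ring.
by apply: eq_const_diff => n; rewrite mulnDr.
Qed.

Lemma const_diff_sum0 d (I : Type) (s : seq I) (P : pred I) (F : I -> nat -> int) :
  (forall i, P i -> const_diff d 0 (F i)) ->
  const_diff d 0 (fun n => \sum_(i <- s | P i) F i n).
Proof.
move=> hF; elim: s => [|i s IH].
  apply: (@eq_const_diff _ _ (fun=> 0)) => [n|]; first by rewrite big_nil.
  elim: d {hF} => [|d IHd] //= h; rewrite mulr0.
  by apply: eq_const_diff IHd => n; rewrite subrr.
case: (boolP (P i)) => hi.
  rewrite -[0]addr0; apply: eq_const_diff (const_diffD (hF _ hi) IH) => n.
  by rewrite big_cons hi.
by apply: eq_const_diff IH => n; rewrite big_cons (negbTE hi).
Qed.

(** By the binomial formula, the difference of [n ^ d.+1] with step [h] is [d.+1 * h * n ^ d] plus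
    terms of degree below [d], and [d] further differences kill those terms. *)
Lemma const_diffX d : const_diff d d`!%:Z (fun n => n%:Z ^+ d).
Proof.
elim/ltn_ind: d => -[_ n|d IH h] /=; first by rewrite expr0.
have hlow : const_diff d 0 (fun n => \sum_(i < d)
    ('C(d.+1, i)%:Z * h%:Z ^+ (d.+1 - i)) * n%:Z ^+ i).
  apply: (@const_diff_sum0 d _ _ predT
    (fun (i : 'I_d) n => ('C(d.+1, i)%:Z * h%:Z ^+ (d.+1 - i)) * n%:Z ^+ i)) => i _.
  rewrite -[0](mulr0 ('C(d.+1, i)%:Z * h%:Z ^+ (d.+1 - i))).
  by apply/const_diffM/(const_diff_lt (ltn_ord i) (IH _ _)); rewrite ltnS ltnW.
have htop := const_diffM (d.+1%:Z * h%:Z) (IH d (ltnSn _)).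
have := const_diffD hlow htop.
have -> : 0 + d.+1%:Z * h%:Z * d`!%:Z = h%:Z * d.+1`!%:Z.
  by rewrite factS PoszM; ring.
apply: eq_const_diff => n /=.
rewrite PoszD (addrC n%:Z) exprDn [in RHS]big_ord_recr /= subnn expr0 mul1r binn mulr1n addrK.
rewrite big_ord_recr /= binSn subSnn expr1; congr (_ + _); last by rewrite -mulr_natr natz; ring.
by apply: eq_bigr => i _; rewrite -mulr_natr natz; ring.
Qed.

(** * Van der Corput's inequality *)

(** Cauchy-Schwarz against the constant 1, from summing [(a n - a m) ^+ 2 >= 0] over all pairs. *)
Lemma sqr_sum_le (C : numClosedFieldType) (N : nat) (a : nat -> C) : (forall n, 0 <= a n) ->
  (\sum_(n < N) a n) ^+ 2 <= N%:R * \sum_(n < N) a n ^+ 2.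
Proof.
move=> a0; rewrite -(ler_pM2l (ltr0Sn _ 1)).
have -> : 2 * (N%:R * \sum_(n < N) a n ^+ 2) =
    \sum_(n < N) \sum_(m < N) (a n ^+ 2 + a m ^+ 2).
  under [RHS]eq_bigr do rewrite big_split sumr_const card_ord /=.
  rewrite big_split sumr_const card_ord /= sumrMnl.
  by rewrite !mulr_natl mulr2n.
rewrite expr2 mulr_suml mulr_sumr; apply: ler_sum => n _.
rewrite mulr_sumr mulr_sumr; apply: ler_sum => m _.
rewrite -subr_ge0 (_ : _ - _ = (a n - a m) ^+ 2); last by ring.
by apply: real_exprn_even_ge0 => //; apply: rpredB; apply: ger0_real.
Qed.

(** Shifting the range by one exchanges two terms of norm at most 1, so a shift by [h] costs at most
    [2 * h]. *)
Lemma vdC_shift (C : numClosedFieldType) (N H : nat) (u : nat -> C) : (forall n, `|u n| <= 1) ->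
  `|\sum_(h < H) \sum_(n < N) u (n + h)%N - H%:R * \sum_(n < N) u n| <= 2 * H%:R ^+ 2.
Proof.
move=> u1.
have one (h : nat) : `|\sum_(n < N) u (n + h)%N - \sum_(n < N) u n| <= 2 * h%:R.
  elim: h => [|h IH]; first by under eq_bigr do rewrite addn0; rewrite subrr normr0 mulr0.
  have -> : \sum_(n < N) u (n + h.+1)%N =
      \sum_(n < N) u (n + h)%N + u (N + h)%N - u h.
    rewrite -[X in X - _](big_ord_recr N (fun n : 'I_N.+1 => u (n + h)%N)).
    rewrite big_ord_recl /= add0n [u h + _]addrC addrK.
    by apply: eq_bigr => i _; rewrite /bump /= add1n addnS addSn.
  rewrite -(natr1 h) mulrDr mulr1.
  have -> : \sum_(n < N) u (n + h)%N + u (N + h)%N - u h - \sum_(n < N) u n =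
      (\sum_(n < N) u (n + h)%N - \sum_(n < N) u n) + (u (N + h)%N - u h) by ring.
  apply: (le_trans (ler_normD _ _)); apply: lerD => //.
  apply: (le_trans (ler_normB _ _)).
  by rewrite (_ : 2 = 1 + 1 :> C) //; apply: lerD.
have -> : H%:R * \sum_(n < N) u n = \sum_(h < H) \sum_(n < N) u n.
  by rewrite sumr_const card_ord mulr_natl.
rewrite -sumrB; apply: (le_trans (ler_norm_sum _ _ _)).
have -> : 2 * H%:R ^+ 2 = \sum_(h < H) 2 * H%:R :> C.
  by rewrite sumr_const card_ord -mulr_natl; ring.
by apply: ler_sum => h _; apply: (le_trans (one _)); rewrite ler_pM2l // ler_nat ltnW.
Qed.

(** Exchange the sums, apply Cauchy-Schwarz in [n] and expand the square: the diagonal [h = h']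
    contributes [H * N], and each of the at most [H ^ 2] other pairs a correlation bounded by
    [B]. *)
Lemma vdC_square (C : numClosedFieldType) (N H : nat) (u : nat -> C) (B : C) :
  (forall n, `|u n| = 1) ->
  (forall h h' : 'I_H, h != h' ->
     `|\sum_(n < N) u (n + h)%N * (u (n + h')%N)^*| <= B) -> 0 <= B ->
  `|\sum_(h < H) \sum_(n < N) u (n + h)%N| ^+ 2 <= N%:R * (H%:R * N%:R + H%:R ^+ 2 * B).
Proof.
move=> u1 hB B0; rewrite exchange_big /=.
have := @sqr_sum_le C N (fun n => `|\sum_(h < H) u (n + h)%N|) (fun n => normr_ge0 _).
move=> hs; apply: (@le_trans _ _ ((\sum_(n < N) `|\sum_(h < H) u (n + h)%N|) ^+ 2)).
  by rewrite lerXn2r ?nnegrE ?normr_ge0 ?sumr_ge0 ?ler_norm_sum // => *; apply: normr_ge0.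
apply: (le_trans hs); rewrite ler_wpM2l ?ler0n //.
rewrite -[leLHS]ger0_norm; last by apply: sumr_ge0 => n _; apply: exprn_ge0.
have -> : \sum_(n < N) `|\sum_(h < H) u (n + h)%N| ^+ 2 =
    \sum_(h < H) \sum_(h' < H) \sum_(n < N) u (n + h)%N * (u (n + h')%N)^*.
  under [RHS]eq_bigr do rewrite exchange_big /=.
  rewrite [RHS]exchange_big /=; apply: eq_bigr => n _.
  rewrite normCK rmorph_sum mulr_suml; apply: eq_bigr => h _.
  by rewrite mulr_sumr.
have diag (h : 'I_H) : \sum_(n < N) u (n + h)%N * (u (n + h)%N)^* = N%:R.
  by under eq_bigr do rewrite -normCK u1 expr1n; rewrite sumr_const card_ord.
rewrite (eq_bigr (fun h : 'I_H => N%:R + \sum_(h' < H | h' != h)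
    \sum_(n < N) u (n + h)%N * (u (n + h')%N)^*)); last first.
  by move=> h _; rewrite (bigD1 h) //= diag.
rewrite big_split /= sumr_const card_ord -[N%:R *+ H]mulr_natl.
set X := \sum_(i < H) \sum_(h' < H | _) _.
have hX : `|X| <= H%:R ^+ 2 * B.
  apply: (le_trans (ler_norm_sum _ _ _)).
  have -> : H%:R ^+ 2 * B = \sum_(h < H) \sum_(h' < H) B.
    by rewrite !sumr_const card_ord -[B *+ H]mulr_natl -[RHS]mulr_natl; ring.
  apply: ler_sum => h _; apply: (le_trans (ler_norm_sum _ _ _)).
  rewrite [leRHS](bigID (fun h' => h' != h)) /=.
  rewrite -[leLHS]addr0; apply: lerD; last exact: sumr_ge0.
  by apply: ler_sum => h' hh'; apply: hB; rewrite eq_sym.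
apply: (le_trans (ler_normD _ _)); apply: lerD => //.
by rewrite ger0_norm // mulr_ge0 ?ler0n.
Qed.

(** * Weyl differencing for the leading coefficient *)

(** A geometric sum: multiplication by [z ^ b - 1] makes it telescope to two boundary terms. *)
Lemma weyl_linear (C : numClosedFieldType) (N : nat) (z : C) (f : nat -> int) (b : int) :
  `|z| = 1 -> const_diff 1 b f -> circ_dist z b * `|\sum_(n < N) z ^ f n| <= 2.
Proof.
move=> z1 /= hf; rewrite /circ_dist -normrM.
have -> : (z ^ b - 1) * \sum_(n < N) z ^ f n = z ^ f N - z ^ f 0%N.
  elim: N => [|N IH]; first by rewrite big_ord0 mulr0 subrr.
  rewrite big_ord_recr /= mulrDr IH.
  have -> : f N.+1 = f N + b.
    by have := hf 1%N N; rewrite addn1 mul1r => /eqP; rewrite subr_eq addrC => /eqP.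
  by rewrite expfzDr ?circ_neq0 //; ring.
by apply: (le_trans (ler_normB _ _)); rewrite !norm_circX.
Qed.

(** Let [T] be the sum over all [H = 9 * E ^ 2] shifts. A large sum forces
    [|T| >= 9EN - 2H^2 >= 6EN], where [N > 54E^3] gives [2H^2 <= 3EN]. If all correlations were
    below [N / H], then [|T|^2 <= 2HN^2 = 18(EN)^2], against the lower bound [36(EN)^2]. *)
Lemma vdC_correlation (C : numClosedFieldType) (E N : nat) (u : nat -> C) :
  (0 < E)%N -> (54 * E ^ 3 < N)%N -> (forall n, `|u n| = 1) ->
  N%:R <= E%:R * `|\sum_(n < N) u n| ->
  exists h h' : 'I_(9 * E ^ 2),
    h != h' /\ N%:R <= (9 * E ^ 2)%N%:R * `|\sum_(n < N) u (n + h)%N * (u (n + h')%N)^*|.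
Proof.
move=> E0 hN u1 hS; set H := (9 * E ^ 2)%N.
have H0 : (0 < H)%N by rewrite /H muln_gt0 expn_gt0 E0.
have HC : 0 < H%:R :> C by rewrite ltr0n.
have EC : 0 < E%:R :> C by rewrite ltr0n.
have NC : 0 < N%:R :> C by rewrite ltr0n; lia.
case: (boolP [exists h : 'I_H, exists h' : 'I_H, (h != h') &&
   (N%:R <= H%:R * `|\sum_(n < N) u (n + h)%N * (u (n + h')%N)^*|)]).
  by move=> /existsP[h /existsP[h' /andP[hh hl]]]; exists h, h'.
rewrite negb_exists => /forallP hno; exfalso.
have hB (h h' : 'I_H) : h != h' ->
    `|\sum_(n < N) u (n + h)%N * (u (n + h')%N)^*| <= N%:R / H%:R.
  move=> hh; have := hno h; rewrite negb_exists => /forallP/(_ h'); rewrite hh /=.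
  rewrite -real_ltNge ?realn ?rpredM ?realn ?normr_real // => /ltW.
  by rewrite ler_pdivlMr // mulrC.
have := vdC_square u1 hB (divr_ge0 (ler0n _ _) (ler0n _ _)).
set T := \sum_(h < H) _ => hT.
have hsh : `|T - H%:R * \sum_(n < N) u n| <= 2 * H%:R ^+ 2.
  by apply: vdC_shift => n; rewrite u1.
have H9 : H%:R = 9 * E%:R ^+ 2 :> C by rewrite /H natrM natrX.
have T6 : 6 * E%:R * N%:R <= `|T|.
  have h1 : 9 * E%:R * N%:R <= `|H%:R * \sum_(n < N) u n|.
    rewrite normrM normr_nat H9 expr2 -!mulrA ler_pM2l ?ltr0n // ler_pM2l //.
  have h2 : `|H%:R * \sum_(n < N) u n| <= `|T| + 2 * H%:R ^+ 2.
    rewrite -[X in `|X| <= _](subKr T); apply: (le_trans (ler_normB _ _)).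
    by rewrite lerD2l.
  have h3 : 2 * H%:R ^+ 2 <= 3 * E%:R * N%:R :> C.
    rewrite -!natrX -!natrM ler_nat; have -> : (2 * H ^ 2 = 3 * E * (54 * E ^ 3))%N.
      by rewrite /H; ring.
    by rewrite leq_mul2l; lia.
  have := le_trans h1 (le_trans h2 (lerD (lexx _) h3)).
  by rewrite -lerBlDr; congr (_ <= _); ring.
have T36 : 36 * (E%:R * N%:R) ^+ 2 <= 18 * (E%:R * N%:R) ^+ 2 :> C.
  have -> : 36 * (E%:R * N%:R) ^+ 2 = (6 * E%:R * N%:R) ^+ 2 :> C by ring.
  apply: (@le_trans _ _ (`|T| ^+ 2)).
    by rewrite lerXn2r ?nnegrE ?normr_ge0 // !mulr_ge0 ?ler0n.
  apply: (le_trans hT).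
  have -> : H%:R ^+ 2 * (N%:R / H%:R) = H%:R * N%:R :> C.
    by rewrite expr2 -mulrA [H%:R * (_ / _)]mulrC divfK // lt0r_neq0.
  by rewrite H9 -subr_ge0 (_ : _ - _ = 0) //; ring.
have EN : 0 < (E%:R * N%:R) ^+ 2 :> C by rewrite exprn_gt0 // mulr_gt0.
by move: T36; rewrite ler_pM2r // ler_nat.
Qed.

(** Induction on the degree: a large sum has a large correlation at some distance [e <= H], which is
    a sum of lower degree with leading term [e * b]. Multiplying by [H!] removes the dependence on
    [e]. The multiplier [W] is fixed before the precision [Z]; only the length [N] has to grow with
    [Z]. *)
Lemma weyl_leading (C : numClosedFieldType) (d E : nat) : (0 < E)%N ->
  exists2 W : nat, (0 < W)%N & forall Z : nat, exists N0 : nat,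
    forall (N : nat) (z : C) (f : nat -> int) (b : int), (N0 <= N)%N -> `|z| = 1 ->
      const_diff d.+1 b f -> N%:R <= E%:R * `|\sum_(n < N) z ^ f n| ->
      Z%:R * circ_dist z (W%:Z * b) <= 1.
Proof.
elim: d E => [|d IH] E E0.
  exists 1%N => // Z; exists (2 * E * Z).+1 => N z f b hN z1 hf hS.
  have NC : 0 < N%:R :> C by rewrite ltr0n; lia.
  have h2 := weyl_linear N z1 hf; rewrite mul1r -(ler_pM2l NC) mulr1.
  have c0 := circ_dist_ge0 z b.
  apply: (@le_trans _ _ ((E%:R * `|\sum_(n < N) z ^ f n|) * (Z%:R * circ_dist z b))).
    by rewrite ler_wpM2r // mulr_ge0 ?ler0n.
  rewrite [leLHS](_ : _ = E%:R * Z%:R * (circ_dist z b * `|\sum_(n < N) z ^ f n|)); last by ring.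
  apply: (@le_trans _ _ (E%:R * Z%:R * 2)); first by rewrite ler_wpM2l // mulr_ge0 ?ler0n.
  by rewrite -!natrM ler_nat; lia.
set H := (9 * E ^ 2)%N.
have H0 : (0 < H)%N by rewrite /H muln_gt0 expn_gt0 E0.
have [W W0 hW] := IH H H0.
exists (W * H`!)%N => [|Z]; first by rewrite muln_gt0 W0 fact_gt0.
(* Replacing [e] by its multiple [H!] multiplies the distance by at most [H!], which is paid for in
   advance. *)
have [N0 hN0] := hW (Z * H`!)%N.
exists (maxn N0 (54 * E ^ 3).+1) => N z f b; rewrite geq_max => /andP[hN hN'] z1 hf hS.
have [h [h' [hh hl]]] := @vdC_correlation C E N (fun n => z ^ f n) E0 hN'
  (fun n => norm_circX _ z1) hS.
(* Both orders of [h] and [h'] reduce to this case with [a] the smaller shift and [e] the gap; one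
   of them needs a conjugation, which preserves the norm. *)
have corr (a e : nat) : (0 < e)%N -> (e <= H)%N ->
    N%:R <= H%:R * `|\sum_(n < N) z ^ f (n + (a + e))%N * (z ^ f (n + a)%N)^*| ->
    Z%:R * circ_dist z ((W * H`!)%N%:Z * b) <= 1.
  move=> e0 eH hc.
  have hg : const_diff d.+1 (e%:Z * b) (fun n => f (n + a + e)%N - f (n + a)%N).
    exact: (@const_diff_shift d.+1 (e%:Z * b) (fun n => f (n + e)%N - f n) a (hf e)).
  have := hN0 N z _ _ hN z1 hg.
  have -> : \sum_(n < N) z ^ (f (n + a + e)%N - f (n + a)%N) =
      \sum_(n < N) z ^ f (n + (a + e))%N * (z ^ f (n + a)%N)^*.
    by apply: eq_bigr => n _; rewrite conj_circX // -expfzDr ?circ_neq0 // addnA.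
  move=> /(_ hc); apply: le_trans.
  have [q hq] : exists q, (H`! = q * e)%N.
    by apply/dvdnP/dvdn_fact; rewrite e0.
  rewrite natrM -mulrA ler_wpM2l ?ler0n //.
  rewrite (_ : (W * H`!)%N%:Z * b = q%:Z * (W%:Z * (e%:Z * b))); last first.
    by rewrite hq !PoszM; ring.
  apply: (le_trans (circ_distM _ _ z1)); rewrite ler_wpM2r ?circ_dist_ge0 // absz_nat ler_nat.
  by rewrite hq leq_pmulr.
have hlt (g g' : 'I_H) : (g' < g)%N -> (g' + (g - g') = g)%N /\ (0 < g - g' <= H)%N.
  move=> lt; split; first by rewrite subnKC // ltnW.
  by rewrite subn_gt0 lt leq_subLR (leq_trans (ltnW (ltn_ord g))) // leq_addl.
case: (ltngtP h' h) => [lt|lt|/val_inj e]; last by rewrite e eqxx in hh.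
  by have [e /andP[e0 eH]] := hlt _ _ lt; apply: (corr h' _ e0 eH); rewrite e.
have [e /andP[e0 eH]] := hlt _ _ lt; apply: (corr h _ e0 eH); rewrite e.
rewrite -norm_conjC rmorph_sum /=; move: hl; congr (_ <= _ * `|_|).
by apply: eq_bigr => n _; rewrite rmorphM /= conjCK mulrC.
Qed.

(** * Control of all coefficients at one scale *)

(** A polynomial without constant term; [c j] is the coefficient of degree [j.+1]. *)
Definition poly_phase (D : nat) (c : nat -> int) (n : nat) : int :=
  \sum_(j < D) c j * n%:Z ^+ j.+1.

(** Only the top term survives [j.+1] differences; the dilation by [s] contributes [s ^ j.+1]. *)
Lemma const_diff_poly_phase (j a s : nat) (c : nat -> int) :
  const_diff j.+1 (j.+1`!%:Z * s%:Z ^+ j.+1 * c j)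
    (fun m => poly_phase j.+1 c (a + s * m)).
Proof.
have hlow : const_diff j.+1 0 (fun n => poly_phase j c n).
  apply: (@const_diff_sum0 j.+1 _ _ predT (fun (i : 'I_j) n => c i * n%:Z ^+ i.+1)) => i _.
  rewrite -[0](mulr0 (c i)); apply/const_diffM/(const_diff_lt _ (const_diffX _)).
  by rewrite ltnS.
have := const_diffD hlow (const_diffM (c j) (const_diffX j.+1)).
rewrite add0r => /(@const_diff_shift _ _ _ a)/(@const_diff_dilate _ _ _ s).
rewrite (_ : s%:Z ^+ j.+1 * _ = j.+1`!%:Z * s%:Z ^+ j.+1 * c j); last by ring.
by apply: eq_const_diff => n; rewrite /poly_phase big_ord_recr /= addnC.
Qed.

Lemma sum_residues (V : zmodType) (s M : nat) (u : nat -> V) :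
  \sum_(n < s * M) u n = \sum_(t < s) \sum_(m < M) u (t + s * m)%N.
Proof.
elim: M => [|M IH].
  by rewrite muln0 big_ord0 big1 // => t _; rewrite big_ord0.
under [RHS]eq_bigr do rewrite big_ord_recr /=.
rewrite big_split /= -IH mulnS addnC big_split_ord /=; congr (_ + _).
by apply: eq_bigr => t _; rewrite addnC.
Qed.

Lemma expn_progression (b s m k : nat) : (0 < s)%N ->
  exists2 q : nat, ((b + s * m) ^ k = b ^ k + s * q)%N & (q <= (b + s * m) ^ k)%N.
Proof.
move=> s0; have le : (b ^ k <= (b + s * m) ^ k)%N.
  by case: k => // k; rewrite leq_exp2r // leq_addr.
have /dvdnP[q hq] : (s %| (b + s * m) ^ k - b ^ k)%N.
  rewrite -eqn_mod_dvd //; apply/eqP.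
  by rewrite -modnXm addnC mulnC modnMDl modnXm.
exists q; first by rewrite (mulnC s q) -hq subnKC.
by rewrite (leq_trans _ (leq_subr (b ^ k) _)) // hq leq_pmulr.
Qed.

(** Along a progression of step [s] each power changes by a multiple of [s]. If every higher
    [s * c i] is close to a period, the terms of index above [j] are therefore nearly constant. *)
Lemma phase_progression (C : numClosedFieldType) (z : C) (D j s a m Y Z : nat)
    (c : nat -> int) : `|z| = 1 -> (0 < s)%N -> (0 < a + s * m <= Y)%N ->
  (forall i, (j < i < D)%N -> Z%:R * circ_dist z (s%:Z * c i) <= 1) ->
  Z%:R * circ_dist z (\sum_(i < D | (j < i)%N)
    (c i * (a + s * m)%N%:Z ^+ i.+1 - c i * a%:Z ^+ i.+1)) <= (D * Y ^ D)%N%:R.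
Proof.
move=> z1 s0 /andP[p0 hY] hc.
apply: (@le_trans _ _ (\sum_(i < D | (j < i)%N) (Y ^ D)%N%:R)).
  apply: (@le_trans _ _ (\sum_(i < D | (j < i)%N) Z%:R * circ_dist z
    (c i * (a + s * m)%N%:Z ^+ i.+1 - c i * a%:Z ^+ i.+1))).
    by rewrite -mulr_sumr ler_wpM2l ?ler0n // circ_dist_sum.
  apply: ler_sum => i ji.
  have [q hq qle] := @expn_progression a s m i.+1 s0.
  have -> : c i * (a + s * m)%N%:Z ^+ i.+1 - c i * a%:Z ^+ i.+1 = q%:Z * (s%:Z * c i).
    have -> : (a + s * m)%N%:Z ^+ i.+1 = ((a + s * m) ^ i.+1)%N%:Z by rewrite -!natz natrX.
    by rewrite hq PoszD PoszM -!natz natrX !natz; ring.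
  apply: (@le_trans _ _ (Z%:R * (q%:R * circ_dist z (s%:Z * c i)))).
    by rewrite ler_wpM2l ?ler0n // -[q in leRHS]absz_nat; apply: circ_distM.
  rewrite mulrCA -[leRHS]mulr1; apply: ler_pM; rewrite ?ler0n ?mulr_ge0 ?circ_dist_ge0 ?ler0n //.
    rewrite ler_nat; apply: (leq_trans qle); apply: (@leq_trans (Y ^ i.+1)).
      by rewrite leq_exp2r.
    by rewrite leq_pexp2l // (leq_trans p0).
  by apply: hc; rewrite ji ltn_ord.
have -> : (D * Y ^ D)%N%:R = \sum_(i < D) (Y ^ D)%N%:R :> C.
  by rewrite sumr_const card_ord natrM mulr_natl.
rewrite [leRHS](bigID (fun i : 'I_D => (j < i)%N)) /= lerDl.
by apply: sumr_ge0 => *; apply: ler0n.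
Qed.

Lemma poly_phase_split (D j : nat) (c : nat -> int) (n : nat) : (j < D)%N ->
  poly_phase D c n = poly_phase j.+1 c n + \sum_(i < D | (j < i)%N) c i * n%:Z ^+ i.+1.
Proof.
move=> jD; rewrite /poly_phase (bigID (fun i : 'I_D => (j < i)%N)) /= addrC; congr (_ + _).
rewrite (big_ord_widen D (fun i => c i * n%:Z ^+ i.+1)) //.
by apply: eq_bigl => i; rewrite -leqNgt ltnS.
Qed.

(** Split the sum into classes modulo [s]. On each class the terms of index above [j] are almost
    constant, so up to an error [M / (2 * E)] they factor out as a number of norm 1. If all
    truncated sums were below [M / (2 * E)], each class would contribute less than [M / E],
    contradicting the size of the whole sum. *)
Lemma large_residue (C : numClosedFieldType) (z : C) (D E j s a M Z : nat)
    (c : nat -> int) : `|z| = 1 -> (j < D)%N -> (0 < s)%N -> (0 < E)%N -> (0 < M)%N ->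
  (2 * E * (D * (a + s * M).+1 ^ D) <= Z)%N ->
  (forall i, (j < i < D)%N -> Z%:R * circ_dist z (s%:Z * c i) <= 1) ->
  (s * M)%N%:R <= E%:R * `|\sum_(n < s * M) z ^ poly_phase D c (a + n)| ->
  exists t, M%:R <= (2 * E)%N%:R * `|\sum_(m < M) z ^ poly_phase j.+1 c (a + t + s * m)|.
Proof.
move=> z1 jD s0 E0 M0 hZ hc; rewrite (sum_residues s M (fun n => z ^ poly_phase D c (a + n))) => hS.
case: (boolP [exists t : 'I_s, M%:R <=
   (2 * E)%N%:R * `|\sum_(m < M) z ^ poly_phase j.+1 c (a + t + s * m)|]).
  by move=> /existsP[t ht]; exists t.
rewrite negb_exists => /forallP hno; exfalso.
have Z0 : (0 < Z)%N by rewrite (leq_trans _ hZ) // !muln_gt0 E0 expn_gt0 /=; lia.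
have hres (t : 'I_s) : E%:R * `|\sum_(m < M) z ^ poly_phase D c (a + (t + s * m))| < M%:R.
  have := hno t; rewrite -real_ltNge ?realn ?rpredM ?realn ?normr_real // => hlt.
  set h := fun n : nat => \sum_(i < D | (j < i)%N) c i * n%:Z ^+ i.+1.
  set S := \sum_(m < M) z ^ poly_phase D c _.
  set S' := \sum_(m < M) _ in hlt.
  have hd : (2 * E)%N%:R * `|S - z ^ h (a + t)%N * S'| <= M%:R.
    rewrite /S /S' mulr_sumr -sumrB.
    apply: (@le_trans _ _ (\sum_(m < M) 1)); last by rewrite sumr_const card_ord.
    apply: (@le_trans _ _ (\sum_(m < M) (2 * E)%N%:R *
        circ_dist z (h (a + t + s * m)%N - h (a + t)%N))).
      rewrite -mulr_sumr ler_wpM2l ?ler0n //; apply: (le_trans (ler_norm_sum _ _ _)).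
      apply: ler_sum => m _; rewrite (poly_phase_split c _ jD) addnA.
      rewrite -/(h (a + t + s * m)%N); set e := h (a + t + s * m)%N - h (a + t)%N.
      have eh : h (a + t + s * m)%N = h (a + t)%N + e by rewrite addrC subrK.
      clearbody e; rewrite eh !expfzDr ?circ_neq0 //.
      set x := z ^ poly_phase _ _ _; set y := z ^ h _.
      rewrite (_ : _ - _ = x * y * (z ^ e - 1)); last by ring.
      by rewrite !normrM !norm_circX // !mul1r.
    apply: ler_sum => m _; rewrite /h -sumrB.
    have tm : (t + s * m <= s * M)%N.
      by rewrite (@leq_trans (s * m.+1)) // ?leq_mul2l ?ltn_ord ?orbT // mulnS leq_add2r ltnW.
    have ZC : 0 < Z%:R :> C by rewrite ltr0n.
    rewrite -(ler_pM2l ZC) mulr1 mulrCA.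
    apply: (@le_trans _ _ ((2 * E)%N%:R * (D * (a + s * M).+1 ^ D)%N%:R)).
      rewrite ler_wpM2l ?ler0n //.
      case: (posnP (a + t + s * m)%N) => [e0|p0]; last first.
        by apply: phase_progression => //; rewrite p0 /=; lia.
      have [e1 e2] : ((a + t)%N = 0%N /\ s * m = 0)%N by lia.
      rewrite e1 e2 addn0 big1 => [|i _]; last by rewrite subrr.
      by rewrite /circ_dist expr0z subrr normr0 mulr0 ler0n.
    by rewrite -natrM ler_nat.
  have : (2 * E)%N%:R * `|S| < 2 * M%:R.
    rewrite -[S](subrK (z ^ h (a + t)%N * S')) (mulr_natl M%:R 2) mulr2n.
    apply: (@le_lt_trans _ _ ((2 * E)%N%:R * (`|S - z ^ h (a + t)%N * S'| + `|S'|))).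
      rewrite ler_wpM2l ?ler0n //; apply: (le_trans (ler_normD _ _)).
      by rewrite normrM norm_circX // mul1r.
    by rewrite mulrDr; apply: ler_ltD.
  by rewrite natrM -mulrA ltr_pM2l // ltr0n.
have : E%:R * `|\sum_(t < s) \sum_(m < M) z ^ poly_phase D c (a + (t + s * m))| < (s * M)%N%:R.
  apply: (@le_lt_trans _ _ (\sum_(t < s) E%:R *
      `|\sum_(m < M) z ^ poly_phase D c (a + (t + s * m))|)).
    by rewrite -mulr_sumr ler_wpM2l ?ler0n // ler_norm_sum.
  rewrite (_ : (s * M)%N%:R = \sum_(t < s) M%:R); last first.
    by rewrite sumr_const card_ord natrM mulr_natl.
  apply: ltr_sum => //; first by apply/hasP; exists (Ordinal s0); rewrite ?mem_index_enum.
by rewrite real_ltNge ?hS // ?realn ?rpredM ?realn ?normr_real.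
Qed.

(* [step_rec W D (D - j)] is the multiplier tested on the coefficient of degree
   [j.+1]; it is a multiple of those used for the higher coefficients. *)
Fixpoint step_rec (W : nat -> nat) (D t : nat) : nat :=
  if t is t'.+1 then
    let j := (D - t)%N in (W j * (j.+1)`! * step_rec W D t' ^ j.+1)%N
  else 1%N.

Lemma step_rec_gt0 W D t : (forall j, 0 < W j)%N -> (0 < step_rec W D t)%N.
Proof. by move=> W0; elim: t => //= t IH; rewrite !muln_gt0 W0 fact_gt0 expn_gt0 IH. Qed.

Lemma step_rec_dvd W D t t' : (t <= t')%N -> (step_rec W D t %| step_rec W D t')%N.
Proof.
elim: t' => [|t' IH]; first by rewrite leqn0 => /eqP ->.
rewrite leq_eqVlt => /predU1P[-> //|]; rewrite ltnS => /IH h.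
by rewrite /= dvdn_mull // expnS dvdn_mulr.
Qed.

Lemma circ_dist_dvd (C : numClosedFieldType) (z : C) (s s' : nat) (c : int) :
  `|z| = 1 -> (0 < s')%N -> (s %| s')%N ->
  circ_dist z (s'%:Z * c) <= s'%:R * circ_dist z (s%:Z * c).
Proof.
move=> z1 s0 /dvdnP[q hq]; rewrite {1}hq PoszM -mulrA.
apply: (le_trans (circ_distM _ _ z1)); rewrite absz_nat ler_wpM2r ?circ_dist_ge0 //.
by rewrite ler_nat hq leq_pmulr //; move: s0; rewrite hq muln_gt0 => /andP[].
Qed.

(** One step of a descent through the degrees: with the higher coefficients under control, some
    residue class carries a large sum whose top index is [j], and [weyl_leading] applies to it. The
    multipliers [s] precede [Z], whereas the length [l] and the precision [Z'] depend on it. *)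
Lemma single_scale (C : numClosedFieldType) (D E : nat) : (0 < E)%N ->
  exists s : nat -> nat, [/\ forall j, (0 < s j)%N,
    forall i j, (j <= i)%N -> (s i %| s j)%N &
    forall Z a : nat, exists l Z' : nat, [/\ (0 < l)%N, (Z <= Z')%N &
      forall (z : C) (c : nat -> int), `|z| = 1 ->
        l%:R <= E%:R * `|\sum_(n < l) z ^ poly_phase D c (a + n)| ->
        forall j, (j < D)%N ->
          (forall i, (j < i < D)%N -> Z'%:R * circ_dist z ((s i)%:Z * c i) <= 1) ->
          Z%:R * circ_dist z ((s j)%:Z * c j) <= 1]].
Proof.
move=> E0; have E20 : (0 < 2 * E)%N by rewrite muln_gt0.
have /choice[W hW] : forall d, exists W : nat, (0 < W)%N /\ forall Z, exists N0 : nat,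
    forall (N : nat) (z : C) (f : nat -> int) (b : int), (N0 <= N)%N -> `|z| = 1 ->
      const_diff d.+1 b f -> N%:R <= (2 * E)%N%:R * `|\sum_(n < N) z ^ f n| ->
      Z%:R * circ_dist z (W%:Z * b) <= 1.
  by move=> d; have [W W0 h] := weyl_leading C d E20; exists W.
have W0 d := (hW d).1.
pose s j := step_rec W D (D - j).
have s0 j : (0 < s j)%N by apply: step_rec_gt0.
have sS j : (j < D)%N -> s j = (W j * (j.+1)`! * s j.+1 ^ j.+1)%N.
  move=> jD; rewrite /s -[in LHS](subnSK jD) /=.
  by have -> : (D - (D - j.+1).+1 = j)%N by lia.
have sdvd i j : (j <= i)%N -> (s i %| s j)%N.
  by move=> ji; apply: step_rec_dvd; lia.
exists s; split=> // Z a.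
have /choice[N0 hN0] : forall d, exists N0 : nat,
    forall (N : nat) (z : C) (f : nat -> int) (b : int), (N0 <= N)%N -> `|z| = 1 ->
      const_diff d.+1 b f -> N%:R <= (2 * E)%N%:R * `|\sum_(n < N) z ^ f n| ->
      Z%:R * circ_dist z ((W d)%:Z * b) <= 1.
  by move=> d; apply: (hW d).2.
(* Every [s j] divides [s 0], so [l] splits evenly into classes for each step [s j.+1], and each
   class is longer than all the [N0 d] with [d < D]. *)
pose M := (\sum_(d < D) N0 d).+1; pose l := (s 0 * M)%N.
pose Y := (2 * E * (D * (a + l).+1 ^ D))%N.
(* [Y] is the precision that [large_residue] requires; the factor [s 0] pays for passing from the
   multiplier [s i] to its multiple [s j.+1]. *)
exists l, (Z + s 0 * Y)%N; split.
- by rewrite muln_gt0 s0.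
- exact: leq_addr.
move=> z c z1 hl j jD hc.
have /dvdnP[q hq] := sdvd j.+1 0%N (leq0n _).
have q0 : (0 < q)%N by have := s0 0%N; rewrite hq muln_gt0 => /andP[].
have el : l = (s j.+1 * (q * M))%N by rewrite /l hq; ring.
have qM : (0 < q * M)%N by rewrite muln_gt0 q0.
have hY : (2 * E * (D * (a + s j.+1 * (q * M)).+1 ^ D) <= Y)%N by rewrite -el.
have hsmall i : (j < i < D)%N -> Y%:R * circ_dist z ((s j.+1)%:Z * c i) <= 1.
  move=> /andP[ji iD].
  apply: (@le_trans _ _ (Y%:R * ((s 0)%:R * circ_dist z ((s i)%:Z * c i)))).
    rewrite ler_wpM2l ?ler0n //; apply: (le_trans (circ_dist_dvd _ z1 (s0 _) (sdvd i j.+1 ji))).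
    by rewrite ler_wpM2r ?circ_dist_ge0 // ler_nat dvdn_leq // sdvd.
  apply: le_trans (hc i _); last by rewrite ji.
  by rewrite mulrA ler_wpM2r ?circ_dist_ge0 // -natrM ler_nat mulnC leq_addl.
rewrite el in hl.
have [t ht] := large_residue z1 jD (s0 _) E0 qM hY hsmall hl.
have := hN0 j (q * M)%N z _ _ _ z1 (const_diff_poly_phase j (a + t) (s j.+1) c) ht.
rewrite (sS j jD) !PoszM -!mulrA => h.
have -> : (s j.+1 ^ j.+1)%N%:Z = (s j.+1)%:Z ^+ j.+1 by rewrite -!natz natrX.
apply: h; rewrite (@leq_trans M) // ?leq_pmull // /M (bigD1 (Ordinal jD)) //=; lia.
Qed.

(** * Averaging over several scales *)

(** The summand [p K] records that no drop has occurred yet, which makes the induction on [K]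
    work. *)
Lemma count_drop_le1 (p : nat -> bool) (K : nat) : (forall i, p i.+1 -> p i) ->
  (\sum_(i < K) (p i && ~~ p i.+1) + p K <= 1)%N.
Proof.
move=> mono; elim: K => [|K IH]; first by rewrite big_ord0 leq_b1.
rewrite big_ord_recr /=; have := mono K; move: IH.
by case: (p K); case: (p K.+1) => //=; lia.
Qed.

(** The density of the mean of [K] uniform probability measures on windows that all start at [a]. *)
Definition window_weight (C : numClosedFieldType) (K a : nat) (l : nat -> nat) (n : nat) : C :=
  K%:R^-1 * \sum_(i < K) (if (a <= n < a + l i)%N then (l i)%:R^-1 else 0).

Lemma big_nat_cond_eq0 (V : nmodType) (m n : nat) (F : nat -> V) :
  (forall i, (m <= i < n)%N -> F i = 0) -> \sum_(m <= i < n) F i = 0.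
Proof. by move=> h; rewrite big_nat big1. Qed.

Lemma window_weightE (C : numClosedFieldType) (K a : nat) (l : nat -> nat) (F : nat -> C) :
  \sum_(n < a + \sum_(i < K) l i) window_weight C K a l n * F n =
  K%:R^-1 * \sum_(i < K) (l i)%:R^-1 * \sum_(m < l i) F (a + m)%N.
Proof.
rewrite /window_weight; under eq_bigr do rewrite -mulrA mulr_suml.
rewrite -mulr_sumr exchange_big /=; congr (_ * _); apply: eq_bigr => i _.
set N := (a + _)%N; have hN : (a + l i <= N)%N.
  by rewrite leq_add2l (bigD1 i) //= leq_addr.
rewrite mulr_sumr.
have -> : \sum_(m < l i) (l i)%:R^-1 * F (a + m)%N =
    \sum_(a <= n < a + l i) (l i)%:R^-1 * F n.
  by rewrite -[X in \sum_(X <= _ < _) _]add0n big_addn addKn big_mkord;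
    apply: eq_bigr => m _; rewrite addnC.
rewrite -(big_mkord xpredT (fun n => (if (a <= n < a + l i)%N then (l i)%:R^-1 else 0) * F n)).
pose G n := (if (a <= n < a + l i)%N then (l i)%:R^-1 else 0) * F n.
rewrite (big_cat_nat (leq0n a) (leq_trans (leq_addr (l i) a) hN)) /=.
rewrite (big_cat_nat (leq_addr (l i) a) hN) /=.
have -> : \sum_(0 <= n < a) G n = 0.
  by apply: big_nat_cond_eq0 => n /andP[_ na]; rewrite /G leqNgt na mul0r.
have -> : \sum_(a + l i <= n < N) G n = 0.
  by apply: big_nat_cond_eq0 => n /andP[na _]; rewrite /G (ltnNge n) na andbF mul0r.
rewrite add0r.
by rewrite addr0 !big_nat; apply: eq_bigr => n /andP[-> ->].
Qed.

(* Averaging over [D * E] well separated scales: each coefficient is neither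
   very close to, nor far from, a multiple of the period at one scale at most. *)
Lemma multi_scale (C : numClosedFieldType) (D E : nat) : (0 < D)%N -> (0 < E)%N ->
  exists2 V : nat, (0 < V)%N & forall Z a : nat, exists (w : nat -> C) (N : nat),
    [/\ forall n, 0 <= w n, forall n, (n < a)%N -> w n = 0, \sum_(n < N) w n = 1 &
    forall (z : C) (c : nat -> int), `|z| = 1 ->
      (forall j, (j < D)%N -> Z%:R * circ_dist z (V%:Z * c j) <= 1) \/
      E%:R * `|\sum_(n < N) w n * z ^ poly_phase D c n| <= 2].
Proof.
move=> D0 E0; have [s [s0 sdvd hs]] := single_scale C D E0.
exists (s 0%N) => // Z a.
have /choice[L hL] : forall Z, exists p : nat * nat, [/\ (0 < p.1)%N, (Z <= p.2)%N &
      forall (z : C) (c : nat -> int), `|z| = 1 ->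
        p.1%:R <= E%:R * `|\sum_(n < p.1) z ^ poly_phase D c (a + n)| ->
        forall j, (j < D)%N ->
          (forall i, (j < i < D)%N -> p.2%:R * circ_dist z ((s i)%:Z * c i) <= 1) ->
          Z%:R * circ_dist z ((s j)%:Z * c j) <= 1].
  by move=> Z1; have [l [Z' h]] := hs Z1 a; exists (l, Z').
(* The precision required at one scale is the one obtained at the next. The initial factor [s 0]
   pays for replacing each [s j] by the common multiplier [s 0]. *)
pose Zs i := iter i (fun Z => (L Z).2) (s 0%N * Z)%N.
pose l i := (L (Zs i)).1.
(* At most [D] scales carry a large sum, so these contribute at most [D / K = 1 / E] to the average,
   and the others at most [1 / E]. *)
pose K := (D * E)%N; have K0 : (0 < K)%N by rewrite muln_gt0 D0.
have l0 i : (0 < l i)%N by case: (hL (Zs i)).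
exists (window_weight C K a l), (a + \sum_(i < K) l i)%N; split.
- move=> n; rewrite mulr_ge0 ?invr_ge0 ?ler0n // sumr_ge0 // => i _.
  by case: ifP; rewrite ?invr_ge0 ?ler0n.
- by move=> n na; rewrite /window_weight big1 ?mulr0 // => i _; rewrite leqNgt na.
- have := window_weightE K a l (fun=> 1 : C); under eq_bigr do rewrite mulr1.
  move=> ->; under eq_bigr do rewrite sumr_const card_ord mulVf ?pnatr_eq0 -?lt0n ?l0 //.
  by rewrite sumr_const card_ord mulVf // pnatr_eq0 -lt0n.
move=> z c z1.
pose near i j := (Zs i)%:R * circ_dist z ((s j)%:Z * c j) <= 1.
have ZsS i : (Zs i <= Zs i.+1)%N by case: (hL (Zs i)).
have near_mono j i : near i.+1 j -> near i j.
  by apply: le_trans; rewrite ler_wpM2r ?circ_dist_ge0 // ler_nat.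
case: (boolP [forall j : 'I_D, near 0%N j]) => [/forallP all0|notall].
  left=> j jD; apply: le_trans (all0 (Ordinal jD)); rewrite /= natrM [(s 0)%:R * _]mulrC.
  rewrite -mulrA ler_wpM2l ?ler0n //.
  by apply: (circ_dist_dvd _ z1) => //; apply: sdvd.
right.
pose S i := \sum_(n < l i) z ^ poly_phase D c (a + n).
pose large i := (l i)%:R <= E%:R * `|S i|.
(* If no coefficient were lost between the scales [i] and [i.+1], descent from the top degree would
   make all of them near at [i.+1], hence at scale 0, which is excluded. *)
have large_drop i : large i -> [exists j : 'I_D, near i j && ~~ near i.+1 j].
  move=> hi; apply: contraR notall; rewrite negb_exists => /forallP hn.
  have step j : (j < D)%N -> near i j -> near i.+1 j.
    by move=> jD hj; have := hn (Ordinal jD); rewrite /= hj /= negbK.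
  have all j : (j < D)%N -> near i.+1 j.
    have [_ _ hl] := hL (Zs i).
    have [m] := ubnP (D - j)%N; elim: m j => // m IH j hm jD; apply: step => //.
    apply: (hl z c z1 hi j jD) => k /andP[jk kD]; apply: IH => //; lia.
  have down k j : near k j -> near 0%N j by elim: k => // k IH /near_mono.
  by apply/forallP => j; apply: (down i.+1); apply: all.
have count_large : (\sum_(i < K) large i <= D)%N.
  apply: (@leq_trans (\sum_(i < K) \sum_(j < D) (near i j && ~~ near i.+1 j))).
    apply: leq_sum => i _; case: (boolP (large i)) => // /large_drop/existsP[j hj].
    by rewrite (bigD1 j) //= hj.
  rewrite exchange_big /= -[X in (_ <= X)%N]card_ord -sum1_card; apply: leq_sum => j _.
  apply: leq_trans (count_drop_le1 (p := fun i => near i j) K _); first exact: leq_addr.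
  by move=> i; apply: near_mono.
rewrite (window_weightE K a l (fun n => z ^ poly_phase D c n)).
have KC : 0 < K%:R :> C by rewrite ltr0n.
have EC : 0 < E%:R :> C by rewrite ltr0n.
rewrite normrM normfV normr_nat.
have hsum : E%:R * `|\sum_(i < K) (l i)%:R^-1 * S i| <= 2 * K%:R.
  apply: (@le_trans _ _ (\sum_(i < K) (E%:R * (large i)%:R + 1))).
    rewrite -[X in _ <= X]mulr1.
    apply: (@le_trans _ _ (\sum_(i < K) E%:R * `|(l i)%:R^-1 * S i|)).
      by rewrite -mulr_sumr ler_wpM2l ?ler0n // ler_norm_sum.
    rewrite mulr1; apply: ler_sum => i _.
    have lC : 0 < (l i)%:R :> C by rewrite ltr0n.
    rewrite normrM normfV normr_nat; case: (boolP (large i)) => hi /=.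
      rewrite -[leLHS]addr0; apply: lerD => //; rewrite ler_pM2l // mulrC ler_pdivrMr // mul1r.
      apply: (le_trans (norm_circ_sum_le _ _ _ z1)); rewrite sumr_const card_ord //.
    rewrite mulr0 add0r mulrCA mulrC ler_pdivrMr // mul1r.
    by move: hi; rewrite -real_ltNge ?realn ?rpredM ?realn ?normr_real // => /ltW.
  rewrite big_split /= -mulr_sumr sumr_const card_ord -natr_sum.
  rewrite (_ : 2 * K%:R = E%:R * D%:R + K%:R); last by rewrite /K natrM; ring.
  by rewrite lerD2r ler_pM2l // ler_nat.
by rewrite mulrCA mulrC ler_pdivrMr.
Qed.

(** * Multiplicative complexity and the Smith normal form *)

Lemma dvdz_gcdz_seq (d : int) (s : seq int) :
  (d %| gcdz_seq s)%Z = all (fun x => (d %| x)%Z) s.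
Proof. by elim: s => [|x s IH] /=; rewrite ?dvdz0 // dvdz_gcd IH. Qed.

Lemma gcdz_seq_ge0 (s : seq int) : 0 <= gcdz_seq s.
Proof. by case: s. Qed.

Definition coef_mx (r D : nat) (P : 'I_r -> {poly int}) : 'M[int]_(r, D) :=
  \matrix_(i, j) (P i)`_j.+1.

(** The column [x] certifies that the entries of [a] have gcd 1; as [q] divides every [b_j], the gcd
    bounded by [Q] is [|q|] itself. *)
Lemma mult_complexity_dvd (r D Q : nat) (P : 'I_r -> {poly int}) (a : 'rV[int]_r)
    (x : 'cV[int]_r) (q : int) :
  mult_complexity D P Q -> a *m x = 1%:M -> q != 0 ->
  (forall j, (q %| (a *m coef_mx D P) 0%R j)%Z) -> (`|q| <= Q)%N.
Proof.
move=> hP hax q0 hq; have := hP (fun i => a 0 i) q.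
set g := gcdz_seq _ => hg.
have g1 : g = 1.
  have : (g %| g)%Z by [].
  rewrite {2}/g dvdz_gcdz_seq /= => /andP[_ /allP hall].
  have : (g %| (a *m x) 0%R 0%R)%Z.
    rewrite mxE; apply: rpred_sum => i _; apply: dvdz_mulr; apply: hall.
    by apply/mapP; exists i; rewrite ?mem_enum.
  rewrite hax mxE eqxx /= dvdz1 => /eqP h.
  by rewrite -[g]gez0_abs ?gcdz_seq_ge0 // h.
have := hg g1; cbv zeta; set b := \sum_(i < r) _; set g' := gcdz_seq _.
have hqg : (q %| g')%Z.
  rewrite dvdz_gcdz_seq /= dvdzz /=; apply/allP => y /mapP[j]; rewrite mem_iota add0n /= => jD ->.
  have -> : b`_j.+1 = (a *m coef_mx D P) 0%R (Ordinal jD).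
    rewrite mxE coef_sum; apply: eq_bigr => i _.
    by rewrite coefZ coefB coefC subr0 !mxE.
  exact: hq.
have g'q : (g' %| q)%Z by have := dvdzz g'; rewrite {2}/g' dvdz_gcdz_seq /= => /andP[].
have g'0 : 0 <= g' by apply: gcdz_seq_ge0.
rewrite -[g']gez0_abs // lez_nat; apply: leq_trans; apply: dvdn_leq => //.
rewrite absz_gt0; apply: contraNneq q0 => g0; by rewrite g0 dvd0z in g'q.
Qed.

(** In the Smith form [L * S * R], the rows of the inverse of [L] are unimodular and their products
    with the coefficient matrix are divisible by the diagonal entries. These are thus nonzero, at
    most [Q] in absolute value, and divide [Q!], so [S] can be inverted up to [Q!]. *)
Lemma coef_mx_right_inverse (r D Q : nat) (P : 'I_r -> {poly int}) :
  mult_complexity D P Q ->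
  exists M : 'M[int]_(D, r), coef_mx D P *m M = (Q`!)%:Z%:M.
Proof.
move=> hP; have [L uL [R uR [d _ hd]]] := int_Smith_normal_form (coef_mx D P).
pose S : 'M[int]_(r, D) := \matrix_(i, j) (d`_i *+ (i == j :> nat)).
have hrow (i : 'I_r) (q : int) : q != 0 ->
    (forall j : 'I_D, (q %| d`_i *+ (i == j :> nat))%Z) -> (`|q| <= Q)%N.
  move=> q0 hq; apply: (@mult_complexity_dvd r D Q P (row i (invmx L)) (col i L)) => //.
    apply/matrixP => u v; rewrite !ord1; transitivity ((invmx L *m L) i i).
      by rewrite !mxE; apply: eq_bigr => k _; rewrite !mxE.
    by rewrite mulVmx // !mxE !eqxx.
  move=> j; rewrite hd -/S -!row_mul !mulmxA mulVmx // mul1mx mxE.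
  rewrite mxE; apply: rpred_sum => k _; apply: dvdz_mulr; rewrite mxE; exact: hq.
(* A zero row of the diagonal form is divisible by every integer, in particular by [Q.+1], which
   exceeds the bound; the same argument excludes zero diagonal entries. *)
have iD (i : 'I_r) : (i < D)%N.
  rewrite ltnNge; apply/negP => Di.
  have : (Q.+1 <= Q)%N; last by rewrite ltnn.
  apply: (hrow i Q.+1%:Z) => // j.
  by rewrite gtn_eqF ?mulr0n ?dvdz0 // (leq_trans (ltn_ord j)).
have d0 (i : 'I_r) : d`_i != 0.
  apply/negP => /eqP di.
  have : (Q.+1 <= Q)%N; last by rewrite ltnn.
  apply: (hrow i Q.+1%:Z) => // j.
  by rewrite di mul0rn dvdz0.
have dQ (i : 'I_r) : (d`_i %| (Q`!)%:Z)%Z.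
  rewrite dvdzE absz_nat; apply: dvdn_fact; rewrite absz_gt0 d0 /=.
  by apply: hrow => // j; case: eqP; rewrite ?mulr1n ?mulr0n ?dvdzz ?dvdz0.
exists (invmx R *m (\matrix_(j, i) (((Q`!)%:Z %/ d`_i)%Z *+ (i == j :> nat))) *m invmx L).
rewrite hd -/S; set S' := \matrix_(j, i) _.
have SS : S *m S' = (Q`!)%:Z%:M.
  apply/matrixP => i k; rewrite !mxE (bigD1 (Ordinal (iD i))) //= big1 => [|j hj].
    rewrite !mxE /= eqxx mulr1n addr0; case: (eqVneq i k) => [<-|ik].
      by rewrite eqxx !mulr1n mulrC divzK.
    by rewrite [_ == _]eq_sym -[_ == _ :> nat]/(i == k) (negbTE ik) !mulr0n mulr0.
  rewrite !mxE; case: (eqVneq (i : nat) j) => [e|_]; last by rewrite mulr0n mul0r.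
  by case/eqP: hj; apply: val_inj.
rewrite !mulmxA -(mulmxA (L *m S)) mulmxV // mulmx1 -(mulmxA L) SS.
by rewrite scalar_mxC -mulmxA mulmxV // mulmx1.
Qed.

(** The coefficients of [x . P] are the row [x] times the coefficient matrix. Its right inverse up
    to [Q!] recovers [Q! * x i] from them, so smallness of all [V * c j] passes to
    [V * Q! * x i]. *)
Lemma weyl_average (C : numClosedFieldType) (D r Q E : nat) : (0 < D)%N -> (0 < E)%N ->
  exists2 W : nat, (0 < W)%N & forall P : 'I_r -> {poly int},
    (forall i, (size (P i) <= D.+1)%N) -> mult_complexity D P Q ->
    forall Z a : nat, exists (w : nat -> C) (N : nat),
    [/\ forall n, 0 <= w n, forall n, (n < a)%N -> w n = 0, \sum_(n < N) w n = 1 &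
    forall (z : C) (x : 'I_r -> int), `|z| = 1 ->
      (forall i, Z%:R * circ_dist z (W%:Z * x i) <= 1) \/
      E%:R * `|\sum_(n < N) w n * z ^ (\sum_i x i * (P i).[n%:Z])| <= 1].
Proof.
move=> D0 E0; have E20 : (0 < 2 * E)%N by rewrite muln_gt0.
have [V V0 hV] := multi_scale C D0 E20.
exists (V * Q`!)%N => [|P hdeg hP Z a]; first by rewrite muln_gt0 V0 fact_gt0.
have [M hM] := coef_mx_right_inverse hP.
pose B := (\sum_i \sum_j `|M j i|)%N.
(* The size [B] of the right inverse depends on [P], so it goes into the precision; the multiplier
   stays uniform in [P]. *)
have [w [N [w0 wa w1 hw]]] := hV (Z * B * D)%N a.
exists w, N; split=> // z x z1.
pose c (j : nat) := \sum_i x i * (P i)`_j.+1.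
have [hnear|hsmall] := hw z c z1; [left=> i | right].
  have hx : (Q`!)%:Z * x i = \sum_j M j i * c j.
    have := congr1 (fun A => ((\row_k x k) *m A) 0 i) hM.
    rewrite mulmxA mul_mx_scalar !mxE => <-; apply: eq_bigr => j _.
    by rewrite mulrC mxE /c; congr (_ * _); apply: eq_bigr => k _; rewrite !mxE.
  rewrite PoszM -mulrA hx mulr_sumr.
  have DC : 0 < D%:R :> C by rewrite ltr0n.
  rewrite -(ler_pM2l DC) mulr1.
  have sum1 : \sum_(j < D) (1 : C) = D%:R by rewrite sumr_const card_ord.
  rewrite -[leRHS]sum1.
  apply: (@le_trans _ _ (\sum_(j < D) (Z * B * D)%N%:R * circ_dist z (V%:Z * c j))); last first.
    by apply: ler_sum => j _; apply: hnear.
  rewrite mulrA -[leRHS]mulr_sumr !natrM.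
  rewrite [leRHS](_ : _ = (D%:R * Z%:R) * (B%:R * \sum_(j < D) circ_dist z (V%:Z * c j)));
    last by ring.
  rewrite ler_wpM2l ?mulr_ge0 ?ler0n // mulr_sumr.
  apply: (le_trans (circ_dist_sum _ _ _ z1)); apply: ler_sum => j _.
  rewrite mulrCA; apply: (le_trans (circ_distM _ _ z1)).
  rewrite ler_wpM2r ?circ_dist_ge0 // ler_nat /B (bigD1 i) //= (bigD1 j) //= -addnA.
  exact: leq_addr.
move: hsmall; rewrite natrM -mulrA -[leRHS]mulr1 ler_pM2l ?ltr0n //.
(* The constant terms of [P] contribute only a factor of norm 1. *)
have -> : \sum_(n < N) w n * z ^ (\sum_i x i * (P i).[n%:Z]) =
    z ^ (\sum_i x i * (P i)`_0) * \sum_(n < N) w n * z ^ poly_phase D c n.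
  rewrite mulr_sumr; apply: eq_bigr => n _; rewrite mulrCA -expfzDr ?circ_neq0 //.
  congr (_ * z ^ _); rewrite /poly_phase /c.
  under [X in _ = _ + X]eq_bigr do rewrite mulr_suml.
  rewrite exchange_big /= -big_split /=; apply: eq_bigr => i _.
  rewrite (horner_coef_wide _ (hdeg i)) big_ord_recl expr0 mulr1 mulrDr mulr_sumr.
  by congr (_ + _); apply: eq_bigr => j _; rewrite mulrA.
by rewrite normrM norm_circX // mul1r.
Qed.

(** * Fourier analysis on a finite torus *)

Lemma prim_root_norm (C : numClosedFieldType) (L : nat) (z : C) :
  L.-primitive_root z -> `|z| = 1.
Proof.
move=> pz; apply/eqP; rewrite -(@pexpr_eq1 _ _ L) ?normr_ge0 ?(prim_order_gt0 pz) //.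
by rewrite -normrX (prim_expr_order pz) normr1.
Qed.

Lemma prim_root_expz (C : numClosedFieldType) (L : nat) (z : C) (u : int) :
  L.-primitive_root z -> (z ^ u == 1) = (L%:Z %| u)%Z.
Proof.
move=> pz; case: u => n; rewrite dvdzE.
  by rewrite -exprnP -(prim_order_dvd pz).
by rewrite NegzE -exprnN abszN invr_eq1 -(prim_order_dvd pz).
Qed.

Lemma sum_prim_root (C : numClosedFieldType) (L : nat) (z : C) (u : int) :
  L.-primitive_root z ->
  \sum_(x < L) z ^ (x%:Z * u) = if (L%:Z %| u)%Z then L%:R else 0.
Proof.
move=> pz; under eq_bigr do rewrite mulrC -exprz_exp -exprnP.
case: ifP => [|/negbT]; rewrite -(prim_root_expz _ pz); [move=> /eqP->|move=> hu].
  by under eq_bigr do rewrite expr1n; rewrite sumr_const card_ord.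
apply/eqP; rewrite -subr_eq0 in hu; rewrite -(inj_eq (mulfI hu)) mulr0.
by rewrite -subrX1 exprnP exprzAC -exprnP (prim_expr_order pz) exp1rz subrr.
Qed.

Definition dotz (r L : nat) (xi : {ffun 'I_r -> 'I_L}) (v : 'I_r -> int) : int :=
  \sum_i (xi i)%:Z * v i.

(** The sum factors over the coordinates into geometric sums. *)
Lemma sum_characters (C : numClosedFieldType) (r L : nat) (z : C) (v : 'I_r -> int) :
  L.-primitive_root z ->
  \sum_(xi : {ffun 'I_r -> 'I_L}) z ^ dotz xi v =
  if [forall i, (L%:Z %| v i)%Z] then (L ^ r)%N%:R else 0.
Proof.
move=> pz; have z0 := circ_neq0 (prim_root_norm pz).
have -> : \sum_(xi : {ffun 'I_r -> 'I_L}) z ^ dotz xi v =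
    \prod_i \sum_(x < L) z ^ (x%:Z * v i).
  rewrite bigA_distr_bigA /=; apply: eq_bigr => xi _; rewrite /dotz.
  by elim/big_rec2: _ => [|i y x _ <-]; rewrite ?expr0z // expfzDr.
under eq_bigr do rewrite (sum_prim_root _ pz).
case: ifP => [/forallP h|/negbT].
  by under eq_bigr do rewrite h; rewrite prodr_const card_ord natrX.
by rewrite negb_forall => /existsP[i /negbTE hi]; rewrite (bigD1 i) //= hi mul0r.
Qed.

Definition fourier_weight (C : numClosedFieldType) (r M L : nat) (z : C)
    (A : {set {ffun 'I_r -> 'I_M}}) (xi : {ffun 'I_r -> 'I_L}) : C :=
  `|\sum_(a in A) z ^ dotz xi (fun i => (a i)%:Z)| ^+ 2.

Definition has_diff (r M : nat) (v : 'I_r -> int) (a b : {ffun 'I_r -> 'I_M}) : bool :=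
  [forall i, (b i)%:Z - (a i)%:Z == v i].

(** Expanding the square and using orthogonality leaves the pairs with [a - b + v] zero modulo
    [2 * M]. The modulus is twice the side of the box so that no wraparound occurs. *)
Lemma fourier_weight_count (C : numClosedFieldType) (r M : nat) (z : C)
    (A : {set {ffun 'I_r -> 'I_M}}) (v : 'I_r -> int) :
  (2 * M).-primitive_root z -> (forall i, `|v i| <= M)%N ->
  \sum_(xi : {ffun 'I_r -> 'I_(2 * M)}) fourier_weight z A xi * z ^ dotz xi v =
  \sum_(a in A) \sum_(b in A) (if has_diff v a b then ((2 * M) ^ r)%N%:R else 0).
Proof.
move=> pz hv; have z1 := prim_root_norm pz; have z0 := circ_neq0 z1.
have -> : \sum_(xi : {ffun 'I_r -> 'I_(2 * M)}) fourier_weight z A xi * z ^ dotz xi v =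
    \sum_(xi : {ffun 'I_r -> 'I_(2 * M)}) \sum_(a in A) \sum_(b in A)
       z ^ dotz xi (fun i => (a i)%:Z - (b i)%:Z + v i).
  apply: eq_bigr => xi _; rewrite /fourier_weight normCK rmorph_sum !mulr_suml.
  apply: eq_bigr => a _; rewrite mulr_sumr mulr_suml; apply: eq_bigr => b _.
  rewrite /= conj_circX // -!expfzDr //; congr (z ^ _); rewrite /dotz -sumrN -!big_split /=.
  by apply: eq_bigr => i _; ring.
rewrite exchange_big /=; apply: eq_bigr => a _.
rewrite exchange_big /=; apply: eq_bigr => b _.
rewrite (sum_characters _ pz); congr (if _ then _ else _).
apply: eq_forallb => i; have := hv i; have := ltn_ord (a i); have := ltn_ord (b i).
move: (v i) (a i : nat) (b i : nat) => w x y hx hy hw.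
apply/idP/eqP => [/dvdzP[q hq]|<-]; last by rewrite addrA subrK subrr dvdz0.
(* The coordinates of [a - b + v] are smaller than [2 * M] in absolute value. *)
have q0 : q = 0 by nia.
by move: hq; rewrite q0; lia.
Qed.

(** * Recurrence for dense subsets of a box *)

(** Thresholds built backwards from index [J], since the averaging weights at index [j] depend on
    the threshold at [j.+1]. The term [W * Z] makes the sets of near frequencies increase; [bnd]
    dominates the polynomial values on the support of the weights. *)
Fixpoint threshold_rec (W J : nat) (bnd : nat -> nat -> nat) (t : nat) : nat :=
  if t is t'.+1 then
    let Z := threshold_rec W J bnd t' in (W * Z + bnd (J - t)%N Z)%N
  else 1%N.

(** For each [n] the character is within [\sum_i |P_i(n)| * circ_dist z (x i) <= 1] of 1, and the
    weights have total mass 1. *)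
Lemma weighted_character_near1 (C : numClosedFieldType) (r N Z : nat) (z : C)
    (w : nat -> C) (P : 'I_r -> {poly int}) (x : 'I_r -> int) : `|z| = 1 -> (0 < Z)%N ->
  (forall n, 0 <= w n) -> \sum_(n < N) w n = 1 ->
  (\sum_(n < N) \sum_i `|(P i).[n%:Z]| <= Z)%N ->
  (forall i, Z%:R * circ_dist z (x i) <= 1) ->
  `|\sum_(n < N) w n * z ^ (\sum_i x i * (P i).[n%:Z]) - 1| <= 1.
Proof.
move=> z1 Z0 w0 w1 hZ hx; rewrite -[in X in _ - X]w1 -sumrB -[leRHS]w1.
apply: (le_trans (ler_norm_sum _ _ _)); apply: ler_sum => n _.
rewrite -{2}[w n]mulr1 -mulrBr normrM ger0_norm // ler_piMr // -/(circ_dist _ _).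
have ZC : 0 < Z%:R :> C by rewrite ltr0n.
rewrite -(ler_pM2l ZC) mulr1.
apply: (@le_trans _ _ (\sum_i `|(P i).[n%:Z]|%N%:R)); last first.
  rewrite -natr_sum ler_nat; apply: leq_trans hZ.
  by rewrite [X in (_ <= X)%N](bigD1 n) //= leq_addr.
apply: (@le_trans _ _ (\sum_i Z%:R * circ_dist z (x i * (P i).[n%:Z]))).
  by rewrite -mulr_sumr ler_wpM2l ?ler0n // circ_dist_sum.
apply: ler_sum => i _; rewrite mulrC.
apply: (@le_trans _ _ (`|(P i).[n%:Z]|%N%:R * circ_dist z (x i) * Z%:R)).
  by rewrite ler_wpM2r ?ler0n // mulrC circ_distM.
by rewrite -mulrA ler_piMr ?ler0n // mulrC.
Qed.

Lemma Re_ge (C : numClosedFieldType) (y b : C) : `|y| <= b -> - b <= 'Re y.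
Proof.
move=> hb; have h : `|'Re y| <= b by apply: le_trans hb; rewrite (leif_normC_Re_Creal y).
have := h; rewrite real_ler_norml ?Creal_Re // => /andP[].
by [].
Qed.

(** Every multiplier [W ^ j] comes with its own polynomial [P j], so that failure of all multipliers
    at once is refuted; [W] and [J] are fixed before these polynomials. *)
Lemma finite_recurrence (D r Q B0 : nat) : (0 < D)%N -> (0 < B0)%N ->
  exists W J : nat, [/\ (0 < W)%N, (0 < J)%N &
    forall (P : nat -> 'I_r -> {poly int}) (a : nat -> nat),
    (forall j i, (size (P j i) <= D.+1)%N) -> (forall j, mult_complexity D (P j) Q) ->
    exists2 M : nat, (0 < M)%N & forall A : {set {ffun 'I_r -> 'I_M}},
      (M ^ r < #|A| * B0)%N ->
      exists j n : nat, [/\ (j < J)%N, (a j <= n)%N &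
        exists b b' : {ffun 'I_r -> 'I_M}, [/\ b \in A, b' \in A &
          has_diff (fun i => (W ^ j)%N%:Z * (P j i).[n%:Z]) b b']]].
Proof.
move=> D0 B00; pose H := (2 ^ r * B0)%N.
have H0 : (0 < H)%N by rewrite muln_gt0 expn_gt0.
(* With [E = 2H] and [J = 3H], summing over [j] gives [J * E * w zero <= (E + J) * wtot = 5H *
   wtot], whereas [wtot <= H * w zero] gives [6H * wtot <= J * E * w zero]. *)
pose E := (2 * H)%N; have E0 : (0 < E)%N by rewrite muln_gt0.
have [W W0 hW] := weyl_average algC r Q D0 E0.
pose J := (3 * H)%N; exists W, J; split=> // [|P a hdeg hP]; first by rewrite muln_gt0.
have /choice[g hg] : forall jZ : nat * nat, exists wN : (nat -> algC) * nat,
    [/\ forall n, 0 <= wN.1 n, forall n, (n < a jZ.1)%N -> wN.1 n = 0,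
      \sum_(n < wN.2) wN.1 n = 1 &
    forall (z : algC) (x : 'I_r -> int), `|z| = 1 ->
      (forall i, jZ.2%:R * circ_dist z (W%:Z * x i) <= 1) \/
      E%:R * `|\sum_(n < wN.2) wN.1 n * z ^ (\sum_i x i * (P jZ.1 i).[n%:Z])| <= 1].
  move=> [j Z]; have [w [N h]] := hW (P j) (hdeg j) (hP j) Z (a j).
  by exists (w, N).
pose bnd j Z := (\sum_(n < (g (j, Z)).2) \sum_i `|(P j i).[n%:Z]|)%N.
pose Zs j := threshold_rec W J bnd (J - j).
have ZsE j : (j < J)%N -> Zs j = (W * Zs j.+1 + bnd j (Zs j.+1))%N.
  move=> jJ; rewrite /Zs -[in LHS](subnSK jJ) /=.
  by have -> : (J - (J - j.+1).+1 = j)%N by lia.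
have Zs0 j : (0 < Zs j)%N.
  by rewrite /Zs; elim: (J - j)%N => //= t IH; rewrite addn_gt0 muln_gt0 W0 IH.
(* Large enough to bound the coordinates of all vectors [W ^ j * P_j(n)] that the averages
   involve. *)
pose M := (\sum_(j < J) W ^ j * bnd j (Zs j.+1)).+1.
exists M => // A hA.
have [z pz] := C_prim_root_exists (isT : (0 < 2 * M)%N).
have z1 := prim_root_norm pz.
have [//|hno] := pselect (exists j n : nat, [/\ (j < J)%N, (a j <= n)%N &
        exists b b' : {ffun 'I_r -> 'I_M}, [/\ b \in A, b' \in A &
          has_diff (fun i => (W ^ j)%N%:Z * (P j i).[n%:Z]) b b']]).
exfalso.
pose w := fourier_weight (L := 2 * M) z A.
have w0 xi : 0 <= w xi by rewrite exprn_ge0.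
pose wtot := \sum_xi w xi.
have dot0 xi : @dotz r (2 * M) xi (fun=> 0) = 0.
  by rewrite /dotz big1 // => i _; rewrite mulr0.
have wtotE : wtot = #|A|%:R * ((2 * M) ^ r)%N%:R.
  have -> : wtot = \sum_xi w xi * z ^ dotz xi (fun=> 0).
    by apply: eq_bigr => xi _; rewrite dot0 expr0z mulr1.
  rewrite (fourier_weight_count A pz) //.
  transitivity (\sum_(b in A) ((2 * M) ^ r)%N%:R : algC); last by rewrite sumr_const mulr_natl.
  apply: eq_bigr => b bA; rewrite (bigD1 b) //= big1 => [|b' /andP[_ bb]].
    by rewrite addr0 ifT //; apply/forallP => i; rewrite subrr.
  case: ifP => // /forallP h; case/eqP: bb; apply/ffunP => i; apply: val_inj => /=.
  by have := h i; rewrite subr_eq0 => /eqP[].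
pose zero : {ffun 'I_r -> 'I_(2 * M)} := [ffun=> Ordinal (isT : (0 < 2 * M)%N)].
have w_zero : w zero = #|A|%:R ^+ 2.
  rewrite /w /fourier_weight (eq_bigr (fun=> 1)) ?sumr_const ?normr_nat // => b _.
  by rewrite /dotz big1 ?expr0z // => i _; rewrite ffunE mul0r.
have A0 : (0 < #|A|)%N by case: #|A| hA.
have tot0 : 0 < wtot by rewrite wtotE -natrM ltr0n muln_gt0 A0 expn_gt0.
(* [A] has density above [1 / B0] in the box, and the box has density [1 / 2 ^ r] in the torus. *)
have tot_zero : wtot <= H%:R * w zero.
  rewrite wtotE w_zero -natrX -!natrM ler_nat expnMn /H.
  have -> : (2 ^ r * B0 * #|A| ^ 2 = #|A| * (2 ^ r * (#|A| * B0)))%N by ring.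
  by rewrite !leq_mul2l ltnW ?orbT.
pose near j (xi : {ffun 'I_r -> 'I_(2 * M)}) :=
  [forall i, (Zs j)%:R * circ_dist z ((W ^ j)%N%:Z * (xi i)%:Z) <= 1].
have near_mono j xi : (j < J)%N -> near j xi -> near j.+1 xi.
  move=> jJ /forallP hj; apply/forallP => i; apply: le_trans (hj i).
  rewrite expnS PoszM -mulrA (ZsE j jJ).
  apply: (@le_trans _ _ ((Zs j.+1)%:R * (W%:R * circ_dist z ((W ^ j)%N%:Z * (xi i)%:Z)))).
    by rewrite ler_wpM2l ?ler0n //; apply: circ_distM.
  by rewrite mulrA -natrM ler_wpM2r ?circ_dist_ge0 // ler_nat mulnC leq_addr.
have near_zero j : near j zero.
  apply/forallP => i; rewrite ffunE /= mulr0 /circ_dist expr0z subrr normr0 mulr0.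
  exact: ler01.
pose F j (xi : {ffun 'I_r -> 'I_(2 * M)}) := \sum_(n < (g (j, Zs j.+1)).2)
   (g (j, Zs j.+1)).1 n * z ^ (\sum_i (W ^ j)%N%:Z * (xi i)%:Z * (P j i).[n%:Z]).
(* This sum is a weighted count of pairs in [A] that differ by [W ^ j * P_j(n)], and such pairs are
   assumed not to exist; the weights vanish for [n < a j]. *)
have sumF j : (j < J)%N -> \sum_xi w xi * F j xi = 0.
  move=> jJ; rewrite /F; under eq_bigr do rewrite mulr_sumr.
  rewrite exchange_big /= big1 // => n _.
  have [_ ga _ _] := hg (j, Zs j.+1).
  have [na|an] := ltnP n (a j).
    by rewrite big1 // => xi _; rewrite (ga n na) mul0r mulr0.
  pose v i := (W ^ j)%N%:Z * (P j i).[n%:Z].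
  transitivity ((g (j, Zs j.+1)).1 n * \sum_xi w xi * z ^ dotz xi v).
    rewrite mulr_sumr; apply: eq_bigr => xi _; rewrite mulrCA; congr (_ * (_ * z ^ _)).
    by apply: eq_bigr => i _; rewrite /v; ring.
  rewrite (fourier_weight_count A pz) => [|i]; last first.
    rewrite /v abszM absz_nat /M ltnW // ltnS (bigD1 (Ordinal jJ)) //=.
    apply: leq_trans (leq_addr _ _); rewrite leq_mul2l /bnd (bigD1 n) //= (bigD1 i) //=.
    by rewrite -addnA leq_addr orbT.
  rewrite big1 ?mulr0 // => b bA; rewrite big1 // => b' bA'; case: ifP => // hd.
  by case: hno; exists j, n; split=> //; exists b, b'.
(* The real part of [F j] is 1 at the zero frequency, nonnegative where [near j] holds, at least
   [-1] on the layer between [near j] and [near j.+1], and at least [-1 / E] elsewhere. *)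
have point j xi : (j < J)%N ->
    E%:R * (xi == zero)%:R <=
    E%:R * 'Re (F j xi) + E%:R * ((near j.+1 xi)%:R - (near j xi)%:R) + 1.
  move=> jJ; have [g0 _ g1 hgx] := hg (j, Zs j.+1).
  have EC : 0 < E%:R :> algC by rewrite ltr0n.
  case: eqP => [->|_].
    have -> : F j zero = 1.
      rewrite -g1; apply: eq_bigr => n _; rewrite big1 ?expr0z ?mulr1 // => i _.
      by rewrite ffunE /= mulr0 mul0r.
    have r1 : (1 : algC) \is Num.real by apply: rpred1.
    by rewrite !near_zero subrr mulr0 addr0 (Creal_ReP _ r1) lerDl ler01.
  rewrite mulr0; case: (boolP (near j xi)) => [hj|hj].
    rewrite (near_mono j) // subrr mulr0 addr0 addr_ge0 ?ler01 // mulr_ge0 ?ler0n //.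
    have hle : (bnd j (Zs j.+1) <= Zs j)%N by rewrite (ZsE j jJ) leq_addl.
    have := weighted_character_near1 z1 (Zs0 j) g0 g1 hle (forallP hj).
    move=> /Re_ge; rewrite raddfB /= (Creal_ReP 1 (rpred1 _)).
    by rewrite lerBrDr addNr.
  rewrite subr0; case: (boolP (near j.+1 xi)) => [hj1|hj1].
    rewrite -mulrDr addr_ge0 ?ler01 // mulr_ge0 ?ler0n //.
    rewrite -lerBlDr sub0r; apply: (@Re_ge _ _ 1); rewrite -g1.
    apply: (le_trans (ler_norm_sum _ _ _)); apply: ler_sum => n _.
    by rewrite normrM norm_circX // mulr1 ger0_norm.
  rewrite mulr0 addr0 -lerBlDr sub0r -ReMl ?realn //; apply: Re_ge.
  rewrite normrM normr_nat.
  have [hnear|//] := hgx z (fun i => (W ^ j)%N%:Z * (xi i)%:Z) z1.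
  case/negP: hj1; apply/forallP => i; have := hnear i.
  by rewrite mulrA -PoszM -expnS.
have per j : (j < J)%N -> E%:R * w zero <=
    E%:R * (\sum_xi w xi * (near j.+1 xi)%:R - \sum_xi w xi * (near j xi)%:R) + wtot.
  move=> jJ.
  have : \sum_xi w xi * (E%:R * (xi == zero)%:R) <= \sum_xi w xi * (E%:R * 'Re (F j xi) +
      E%:R * ((near j.+1 xi)%:R - (near j xi)%:R) + 1).
    by apply: ler_sum => xi _; rewrite ler_wpM2l ?w0 // point.
  have -> : \sum_xi w xi * (E%:R * (xi == zero)%:R) = E%:R * w zero.
    rewrite (bigD1 zero) //= eqxx mulr1 big1 ?addr0 1?mulrC // => xi /negbTE ->.
    by rewrite !mulr0.
  have -> : \sum_xi w xi * (E%:R * 'Re (F j xi) +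
      E%:R * ((near j.+1 xi)%:R - (near j xi)%:R) + 1) =
      E%:R * 'Re (\sum_xi w xi * F j xi) +
      E%:R * (\sum_xi w xi * (near j.+1 xi)%:R - \sum_xi w xi * (near j xi)%:R) + wtot.
    rewrite raddf_sum /= -sumrB !mulr_sumr -!big_split /=; apply: eq_bigr => xi _.
    by rewrite ReMl ?ger0_real //; ring.
  by rewrite sumF // raddf0 mulr0 add0r.
(* The weights of the layers telescope, so their sum over all [j] is at most [wtot]. *)
have total k : (k <= J)%N -> (k * E)%N%:R * w zero <=
   E%:R * (\sum_xi w xi * (near k xi)%:R - \sum_xi w xi * (near 0%N xi)%:R) + k%:R * wtot.
  elim: k => [|k IH] kJ; first by rewrite mul0n !mul0r subrr mulr0 addr0.
  have := lerD (IH (ltnW kJ)) (per k kJ); rewrite (mulSn k E) natrD mulrDl [E%:R * w zero + _]addrC.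
  by congr (_ <= _); rewrite -(natr1 k); ring.
have := total J (leqnn _) => htot.
have h5 : (J * E)%N%:R * w zero <= (5 * H)%N%:R * wtot.
  apply: (le_trans htot); rewrite (_ : 5 * H = E + J)%N; last by rewrite /E /J; ring.
  rewrite natrD [leRHS]mulrDl lerD2r ler_wpM2l ?ler0n //.
  apply: (@le_trans _ _ (\sum_xi w xi * (near J xi)%:R)).
    by rewrite lerBlDr lerDl; apply: sumr_ge0 => xi _; rewrite mulr_ge0 ?ler0n.
  by apply: ler_sum => xi _; rewrite ler_piMr // lern1 leq_b1.
have h6 : (6 * H)%N%:R * wtot <= (J * E)%N%:R * w zero.
  rewrite (_ : J * E = 6 * H * H)%N; last by rewrite /J /E; ring.
  by rewrite [(6 * H * H)%N%:R]natrM -mulrA ler_wpM2l ?ler0n.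
have := le_trans h6 h5; rewrite ler_pM2r // ler_nat leq_mul2r; lia.
Qed.

(** * From measure preserving actions to dense sets of return times *)

(** Integrate the number of [i] with [x] in [S i]: the integral is the sum of the measures, which
    exceeds [eps * #|I|]. *)
Lemma exists_frequent_point (R : realType) (d : measure_display) (X : measurableType d)
    (mu : probability X R) (I : finType) (S : I -> set X) (eps : R) :
  (0 < #|I|)%N -> (forall i, measurable (S i)) -> (forall i, (eps%:E < mu (S i))%E) ->
  exists x, eps * #|I|%:R < #|[pred i | x \in S i]|%:R.
Proof.
move=> I0 mS hS; apply: contrapT => hno.
have hle x : (#|[pred i | x \in S i]|%:R <= eps * #|I|%:R :> R).
  by rewrite leNgt; apply/negP => h; apply: hno; exists x.
have mf i : measurable_fun setT (fun x => (\1_(S i) x : R)%:E).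
  by apply/measurable_EFinP; apply: measurable_indic.
have f0 i x : setT x -> (0 <= (\1_(S i) x : R)%:E)%E by move=> _; rewrite lee_fin.
have := ge0_integral_sum mu measurableT mf f0 (index_enum I).
have -> : (\sum_(i <- index_enum I) \int[mu]_(x in setT) (\1_(S i) x : R)%:E)%E =
    (\sum_i fine (mu (S i)))%:E.
  rewrite -sumEFin; apply: eq_bigr => i _.
  by rewrite (integral_indic mu measurableT (mS i)) setIT fineK // fin_num_measure.
have : (\int[mu]_(x in setT) (\sum_(i <- index_enum I) (\1_(S i) x : R)%:E) <=
        (eps * #|I|%:R)%:E)%E.
  have -> : (eps * #|I|%:R)%:E = (\int[mu]_(x in setT) cst (eps * #|I|%:R)%:E x)%E.
    by rewrite integral_cst // (_ : (mu : measure X R) setT = 1%E) ?mule1 //;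
      apply: probability_setT.
  apply: ge0_le_integral => //.
  - by move=> x _; apply: sume_ge0 => i _; apply: f0.
  - exact: emeasurable_sum.
  move=> x _; rewrite sumEFin lee_fin; apply: le_trans (hle x).
  have -> // : #|[pred i | x \in S i]|%:R = \sum_i \1_(S i) x :> R.
  rewrite -sum1_card natr_sum big_mkcond /=; apply: eq_bigr => i _.
  by rewrite indicE unfold_in /=; case: (x \in S i).
move=> h1 h2; move: h1; rewrite h2 lee_fin leNgt => /negP; apply.
rewrite mulr_natr -sumr_const; apply: ltr_sum => [|i _].
  by case/card_gt0P: I0 => i _; apply/hasP; exists i; rewrite ?mem_index_enum.
by rewrite -lte_fin fineK ?fin_num_measure.
Qed.

Lemma mp_action_imageE (R : realType) (d : measure_display) (X : measurableType d)
    (mu : probability X R) (r : nat) (T : 'rV[int]_r -> X -> X) (u : 'rV[int]_r) (A : set X) :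
  mp_action mu T -> T u @` A = T (- u) @^-1` A.
Proof.
case=> T0 TD _ _.
have K v x : T (- v) (T v x) = x.
  by have := congr1 (fun f => f x) (TD (- v) v); rewrite addNr T0.
apply/seteqP; split=> [_ [x Ax <-]|x Ax]; first by rewrite /preimage /= K.
by exists (T (- u) x) => //; rewrite -[u in T u _]opprK K.
Qed.

Definition int_vec (r M : nat) (a : {ffun 'I_r -> 'I_M}) : 'rV[int]_r := \row_i (a i)%:Z.

(** Removing from [B] the countably many null intersections keeps its measure. The set [A] collects
    the times at which the orbit of a frequent point visits the remainder; two times differing by a
    bad [v j n] would place an orbit point in a removed set. *)
Lemma orbit_point_avoiding (R : realType) (d : measure_display) (X : measurableType d)
    (mu : probability X R) (r M : nat) (T : 'rV[int]_r -> X -> X) (eps : R) (B : set X)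
    (v : nat -> nat -> 'rV[int]_r) (bad : nat -> nat -> bool) :
  mp_action mu T -> (0 < M)%N -> measurable B -> (eps%:E < mu B)%E ->
  (forall j n, bad j n -> mu (T (v j n) @` B `&` B) = 0%E) ->
  exists2 A : {set {ffun 'I_r -> 'I_M}}, eps * (M ^ r)%N%:R < #|A|%:R &
    forall a b j n, a \in A -> b \in A -> bad j n -> int_vec b <> v j n + int_vec a.
Proof.
move=> hT M0 mB hB hbad; have [T0 TD mT pT] := hT.
have mpre u A : measurable A -> measurable (T u @^-1` A).
  by move=> mA; rewrite -[_ @^-1` _]setTI; apply: mT.
pose G j n := if bad j n then T (v j n) @` B `&` B else set0.
have mG j n : measurable (G j n).
  rewrite /G; case: ifP => // _; apply: measurableI => //.
  by rewrite (mp_action_imageE _ _ hT); apply: mpre.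
pose U := \bigcup_j \bigcup_n G j n.
have mU : measurable U by do 2 apply: bigcup_measurable => ? _.
have U0 : mu U = 0%E.
  apply: measure_negligible => //; apply: negligible_bigcup => j; apply: negligible_bigcup => n.
  apply/negligibleP => //; rewrite /G; case: ifP => [/hbad //|_]; exact: measure0.
pose B' := B `\` U.
have mB' : measurable B' by apply: measurableD.
have muB' : mu B' = mu B.
  have fB : (mu B < +oo)%E by rewrite ltey_eq fin_num_measure.
  rewrite measureD // [X in (_ - X)%E](_ : _ = 0%E) ?sube0 //.
  by apply: (@subset_measure0 _ _ _ mu _ U) => //; apply: measurableI.
pose S (a : {ffun 'I_r -> 'I_M}) := T (int_vec a) @^-1` B'.
have hS a : (eps%:E < mu (S a))%E by rewrite pT // muB'.
have [|x hx] := @exists_frequent_point R d X mu _ S eps _ (fun a => mpre _ _ mB') hS.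
  by rewrite card_ffun !card_ord expn_gt0 M0.
exists (finset (fun a => x \in S a)).
  by move: hx; rewrite card_ffun !card_ord cardsE.
move=> a b j n; rewrite !inE /S /= => -[Ba _] [Bb Ub] hjn hab.
apply: Ub; exists j => //; exists n => //; rewrite /G hjn; split => //.
by exists (T (int_vec a) x) => //; rewrite hab TD.
Qed.

(** * A uniformly bounded multiplier *)

Theorem theoremC (R : realType) (D r Q : nat) (eps : R) :
  (0 < D)%N -> (0 < r)%N -> (0 < Q)%N -> 0 < eps ->
  exists k0 : nat, (0 < k0)%N /\
    forall (d : measure_display) (X : measurableType d) (mu : probability X R)
           (T : 'rV[int]_r -> X -> X),
      mp_action mu T -> ergodic_action mu T ->
      forall B : set X, measurable B -> (eps%:E < mu B)%E ->
      exists k : nat, [/\ (0 < k)%N, (k <= k0)%N &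
        forall P : 'I_r -> {poly int},
          (forall i, (size (P i) <= D.+1)%N) ->
          mult_complexity D P Q ->
          hyperplane_fleeing R P ->
          forall N : int, exists n : int, N <= n /\
            (0 < mu (T (k%:Z *: polyvec_eval P n) @` B `&` B))%E].
Proof.
move=> D0 _ _ eps0.
(* An integer with [1 / B0 < eps], turning the density [eps] into an integer inequality. *)
pose B0 := (Num.Def.trunc eps^-1).+1.
have epsB0 : 1 < eps * B0%:R.
  by rewrite mulrC -ltr_pdivrMr // mul1r /B0 truncnS_gt.
have [W [J [W0 J0 hfin]]] := @finite_recurrence D r Q B0 D0 isT.
exists (W ^ J)%N; split=> [|d X mu T hT _ B mB hB]; first by rewrite expn_gt0 W0.
apply: contrapT => hno.
(* The cap lets the choice below run over all [j] while [W ^ e j] stays below [k0]; for [j < J] it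
   changes nothing. *)
pose e j := minn j J.-1.
(* If no [k] works, each [k = W ^ e j] has a polynomial and a bound beyond which all the
   intersections are null. *)
have /choice[PN hPN] : forall j, exists PN : ('I_r -> {poly int}) * int,
    [/\ forall i, (size (PN.1 i) <= D.+1)%N, mult_complexity D PN.1 Q &
      forall n : int, PN.2 <= n ->
        mu (T ((W ^ e j)%N%:Z *: polyvec_eval PN.1 n) @` B `&` B) = 0%E].
  move=> j; apply: contrapT => hj; apply: hno; exists (W ^ e j)%N; split.
  - by rewrite expn_gt0 W0.
  - by rewrite leq_pexp2l // geq_min leq_pred orbT.
  move=> P hdeg hP _ N; apply: contrapT => hN; apply: hj; exists (P, N); split=> // n Nn.
  apply/eqP; rewrite eq_le measure_ge0 andbT leNgt; apply/negP => hpos.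
  by apply: hN; exists n.
pose P j := (PN j).1; pose a j := `|(PN j).2|%N.
have hdeg j i : (size (P j i) <= D.+1)%N by have [h _ _] := hPN j; apply: h.
have hP j : mult_complexity D (P j) Q by have [_ h _] := hPN j; apply: h.
have [M M0 hM] := hfin P a hdeg hP.
pose v j n := (W ^ j)%N%:Z *: polyvec_eval (P j) n%:Z.
have hbad j n : (j < J)%N && (a j <= n)%N -> mu (T (v j n) @` B `&` B) = 0%E.
  move=> /andP[jJ an]; have [_ _ h] := hPN j.
  have ej : e j = j by rewrite /e; lia.
  by rewrite /v -{1}ej; apply: h; rewrite (le_trans (lez_abs _)) // lez_nat.
have [A hA hAv] := orbit_point_avoiding hT M0 mB hB hbad.
have hcard : (M ^ r < #|A| * B0)%N.
  rewrite -(ltr_nat R) natrM.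
  have B0R : 0 < B0%:R :> R by rewrite ltr0n.
  apply: (@lt_trans _ _ (eps * (M ^ r)%N%:R * B0%:R)); last by rewrite ltr_pM2r.
  by rewrite mulrAC ltr_pMl // ltr0n expn_gt0 M0.
have [j [n [jJ an [b [b' [bA bA' /forallP hd]]]]]] := hM A hcard.
apply: (hAv b b' j n bA bA'); first by rewrite jJ.
apply/rowP => i; rewrite !mxE; have /eqP <- := hd i; by rewrite subrK.
Qed.
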